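(* In the budget reset problem described in the context, for every $\boldsymbol{x}\in\partial\mathcal{S}_{\mathcal{R}}\setminus\partial\Omega$ and every $b\in(0,B)$, $$\lim_{\substack{\boldsymbol{x}'\to\boldsymbol{x}\\ \boldsymbol{x}'\in\mathcal{U}}}w_1(\boldsymbol{x}',b)=w_2(\boldsymbol{x}).$$
   Context: **Dynamics and costs.** Let $\Omega\subset\mathbb{R}^n$ be open and bounded, $A\subset\mathbb{R}^n$ compact, and $\mathcal{A}$ the set of measurable functions $\boldsymbol{a}:[0,\infty)\to A$ (admissible controls). For a control $\boldsymbol{a}(\cdot)$ and a starting point $\boldsymbol{x}$, the path $\boldsymbol{y}(\cdot)$ solves $\dot{\boldsymbol{y}}(t)=\boldsymbol{f}(\boldsymbol{y}(t),\boldsymbol{a}(t))$, $\boldsymbol{y}(0)=\boldsymbol{x}$. The running cost is $K:\overline{\Omega}\times A\to\mathbb{R}$ and the terminal cost is $q:\partial\Omega\to(-\infty,+\infty]$. The total cost is $\mathcal{J}(\boldsymbol{x},\boldsymbol{a}(\cdot))=\int_0^{T}K(\boldsymbol{y}(s),\boldsymbol{a}(s))\,ds+q(\boldsymbol{y}(T))$, where $T=\min\{t\mid \boldsymbol{y}(t)\in\partial\Omega\}$. **Standing assumptions.** (A1) $\boldsymbol{f}:\overline{\Omega}\times A\to\mathbb{R}^n$ and $K$ are Lipschitz continuous. (A2) There are constants $K_1,K_2$ with $0<K_1\le K(\boldsymbol{x},\boldsymbol{a})\le K_2$ for all $\boldsymbol{x}\in\overline{\Omega}$, $\boldsymbol{a}\in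 A$. (A3) There are constants $F_1,F_2$ such that $\|\boldsymbol{f}\|\le F_2$, and for every $\boldsymbol{x}\in\overline{\Omega}$ and every unit vector $\boldsymbol{v}\in\mathbb{R}^n$ there is $\boldsymbol{a}\in A$ with $\boldsymbol{v}\cdot\boldsymbol{f}(\boldsymbol{x},\boldsymbol{a})=\|\boldsymbol{f}(\boldsymbol{x},\boldsymbol{a})\|\ge F_1>0$. Moreover the scaled vectogram $\{\boldsymbol{f}(\boldsymbol{x},\boldsymbol{a})/K(\boldsymbol{x},\boldsymbol{a})\mid\boldsymbol{a}\in A\}$ is strictly convex for each $\boldsymbol{x}\in\Omega$. (A4) $q$ is lower semicontinuous and $\min_{\partial\Omega}q<\infty$. **Safe/unsafe splitting and budget.** $\overline{\Omega}=\mathcal{U}\cup\mathcal{S}$ is a partition with $\mathcal{U}$ (unsafe set) open, so $\partial\Omega\subset\mathcal{S}$ (safe set). The set $\mathcal{S}\setminus\{\boldsymbol{x}\in\partial\Omega\mid q(\boldsymbol{x})<\infty\}$ is assumed to have finitely many connected components. $B>0$ is the maximum budget. The secondary cost (budget decrease rate) $\hat K$ on $\mathcal{U}\times A$ is Lipschitz continuous with $0<\hat K_1\le\hat K(\boldsymbol{x},\boldsymbol{a})\le\hat K_2$ for all $\boldsymbol{x}\in\mathcal{U}$, $\boldsymbol{a}\in A$. Along a path the budget $\beta(t)$ evolves by the hybrid rule: $\dot\beta(t)=-\hat K(\boldsymbol{y}(t),\boldsymbol{a}(t))$ while $\boldsymbol{y}(t)\in\mathcal{U}$, and $\beta(t)=B$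 whenever $\boldsymbol{y}(t)\in\mathcal{S}$ (so the budget is instantaneously reset to $B$ on entering $\mathcal{S}$); initially $\beta(0)=b$ if $\boldsymbol{y}(0)\in\mathcal{U}$ and $\beta(0)=B$ if $\boldsymbol{y}(0)\in\mathcal{S}$. **Value function.** Let $\tilde T(\boldsymbol{x},b,\boldsymbol{a})=\min\{t\mid\boldsymbol{y}(t)\in\partial\Omega,\ \beta(\tau)\ge0\ \text{for all }\tau\in[0,t]\}$ (equal to $+\infty$ if no such $t$ exists), and let $\tilde{\mathcal{A}}(\boldsymbol{x},b)=\{\boldsymbol{a}\in\mathcal{A}\mid\tilde T(\boldsymbol{x},b,\boldsymbol{a})<\infty\}$ be the set of feasible controls. The corresponding paths are called feasible. Set $w(\boldsymbol{x},b)=\inf_{\boldsymbol{a}(\cdot)\in\tilde{\mathcal{A}}(\boldsymbol{x},b)}\mathcal{J}(\boldsymbol{x},\boldsymbol{a}(\cdot))$, with $\inf\emptyset=+\infty$. Write $w_1(\boldsymbol{x},b)=w(\boldsymbol{x},b)$ for $(\boldsymbol{x},b)\in\mathcal{U}\times(0,B]$, and $w_2(\boldsymbol{x})=w(\boldsymbol{x},B)$ for $\boldsymbol{x}\in\mathcal{S}$. **Reachable safe set.** $\mathcal{S}_{\mathcal{R}}=\{\boldsymbol{x}\in\mathcal{S}\mid w_2(\boldsymbol{x})<\infty\}$. *)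

(* Defs.v *)
From HB Require Import structures.
From mathcomp Require Import all_boot all_order all_algebra.
From mathcomp Require Import all_classical all_reals all_analysis.
Import Order.TTheory GRing.Theory Num.Theory.
Import numFieldNormedType.Exports.

Set Implicit Arguments.
Unset Strict Implicit.
Unset Printing Implicit Defensive.

Local Open Scope classical_set_scope.
Local Open Scope ring_scope.

Definition boundary {T : topologicalType} (X : set T) : set T :=
  closure X `\` X°.

(* The library norm on 'rV[R]_n is the sup norm; it induces the same topology
   and the same Lipschitz and bounded objects, but [controllable] needs the
   Euclidean one. *)
Definition dotv {R : realType} {n : nat} (u v : 'rV[R]_n) : R :=
  \sum_(i < n) u ord0 i * v ord0 i.

Definition enorm {R : realType} {n : nat} (v : 'rV[R]_n) : R :=
  Num.sqrt (dotv v v).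

Definition strictly_convex {R : realType} {n : nat} (C : set 'rV[R]_n) : Prop :=
  forall (p r : 'rV[R]_n) (t : R), C p -> C r -> p <> r -> 0 < t < 1 ->
    C° (t *: p + (1 - t) *: r).

Definition is_minimum {R : realType} (E : set R) (m : R) : Prop :=
  E m /\ lbound E m.

(* The functions are total; only their values on the domains intended
   (closure Omega x A for f and K, the boundary of Omega for q, U x A for Khat)
   are constrained or used. *)
Record budget_reset_problem (R : realType) (n : nat) := BudgetResetProblem {
  Omega : set 'rV[R]_n ;
  A : set 'rV[R]_n ;
  f : 'rV[R]_n -> 'rV[R]_n -> 'rV[R]_n ;
  K : 'rV[R]_n -> 'rV[R]_n -> R ;
  q : 'rV[R]_n -> \bar R ;
  U : set 'rV[R]_n ;
  S : set 'rV[R]_n ;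
  B : R ;
  Khat : 'rV[R]_n -> 'rV[R]_n -> R
}.

Section Assumptions.
Context {R : realType} {n : nat}.
Variable P : budget_reset_problem R n.

Definition lipschitz_data : Prop :=
  [lipschitz f P z.1 z.2 | z in closure (Omega P) `*` A P] /\
  [lipschitz K P z.1 z.2 | z in closure (Omega P) `*` A P].

Definition bounded_running_cost : Prop :=
  exists K1 K2 : R, 0 < K1 /\
    forall x a, closure (Omega P) x -> A P a -> K1 <= K P x a <= K2.

Definition controllable : Prop :=
  exists F1 F2 : R,
    [/\ 0 < F1,
        forall x a, closure (Omega P) x -> A P a -> enorm (f P x a) <= F2 &
        forall x v, closure (Omega P) x -> enorm v = 1 ->
          exists a, [/\ A P a, dotv v (f P x a) = enorm (f P x a) &
                        F1 <= enorm (f P x a)]].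

Definition scaled_vectogram (x : 'rV[R]_n) : set 'rV[R]_n :=
  [set (K P x a)^-1 *: f P x a | a in A P].

(* Lower semicontinuity is relative to the boundary: in the topology of
   [subspace D] the points outside D are isolated and carry no condition. *)
Definition exit_cost_assumption : Prop :=
  [/\ forall x, boundary (Omega P) x -> q P x <> -oo%E,
      lower_semicontinuous (q P : subspace (boundary (Omega P)) -> \bar R) &
      (ereal_inf (q P @` boundary (Omega P)) < +oo)%E].

Definition safe_without_exits : set 'rV[R]_n :=
  S P `\` [set x | boundary (Omega P) x /\ (q P x < +oo)%E].

Definition safe_unsafe_splitting : Prop :=
  [/\ U P `|` S P = closure (Omega P),
      U P `&` S P = set0,
      open (U P),
      boundary (Omega P) `<=` S P &
      finite_set [set connected_component safe_without_exits x
                 | x in safe_without_exits]].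

Definition budget_rate_assumption : Prop :=
  [lipschitz Khat P z.1 z.2 | z in U P `*` A P] /\
  exists k1 k2 : R, 0 < k1 /\
    forall x a, U P x -> A P a -> k1 <= Khat P x a <= k2.

Record standing_assumptions : Prop := StandingAssumptions {
  Omega_open : open (Omega P) ;
  Omega_bounded : bounded_set (Omega P) ;
  A_compact : compact (A P) ;
  Lipschitz_data : lipschitz_data ;
  Running_cost : bounded_running_cost ;
  Controllability : controllable ;
  Vectogram_convex : forall x, Omega P x -> strictly_convex (scaled_vectogram x) ;
  Exit_cost : exit_cost_assumption ;
  Splitting : safe_unsafe_splitting ;
  B_gt0 : 0 < B P ;
  Budget_rate : budget_rate_assumption
}.

End Assumptions.

Section ValueFunction.
Context {R : realType} {n : nat}.
Variable P : budget_reset_problem R n.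
Notation mu := (@lebesgue_measure R).

(* Borel measurability on R^n is coordinatewise. *)
Definition admissible (a : R -> 'rV[R]_n) : Prop :=
  (forall t, 0 <= t -> A P (a t)) /\
  forall i : 'I_n, measurable_fun (`[0, +oo[ : set R) (fun t : R => a t ord0 i).

(* Caratheodory solution on [0, t] of y' = f(y, a), y(0) = x; the integral
   equation at time 0 gives the initial condition. *)
Definition is_path (x : 'rV[R]_n) (a : R -> 'rV[R]_n) (t : R)
    (y : R -> 'rV[R]_n) : Prop :=
  [/\ {within `[0, t], continuous y},
      forall s, 0 <= s <= t -> closure (Omega P) (y s) &
      forall s (i : 'I_n), 0 <= s <= t ->
        y s ord0 i =
        x ord0 i + \int[mu]_(r in `[0, s]) (f P (y r) (a r) ord0 i)].

(* The hybrid budget rule on [0, t].  The evolution law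
   beta' = - Khat(y, a) in U is integrated over the intervals ]s, r] spent in U;
   y s itself may be in S, in which case the decrease starts from
   beta s = B at the moment of leaving S. *)
Definition is_budget (b : R) (a y : R -> 'rV[R]_n) (t : R) (beta : R -> R)
    : Prop :=
  [/\ forall s, 0 <= s <= t -> S P (y s) -> beta s = B P,
      U P (y 0) -> beta 0 = b &
      forall s r, 0 <= s <= r -> r <= t ->
        (forall u, s < u <= r -> U P (y u)) ->
        beta r = beta s - \int[mu]_(u in `[s, r]) (Khat P (y u) (a u))].

Definition exit_times (y : R -> 'rV[R]_n) : set R :=
  [set t | 0 <= t /\ boundary (Omega P) (y t)].

Definition budget_exit_times (y : R -> 'rV[R]_n) (beta : R -> R) : set R :=
  exit_times y `&` [set t | forall s, 0 <= s <= t -> 0 <= beta s].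

(* The control a, with its path y and budget beta, is feasible from (x, b) and
   its exit time subject to the budget constraint is t.  The path is only
   considered up to t, since f is not given outside closure Omega. *)
Definition feasible (x : 'rV[R]_n) (b : R) (a y : R -> 'rV[R]_n)
    (beta : R -> R) (t : R) : Prop :=
  [/\ admissible a, is_path x a t y, is_budget b a y t beta &
      is_minimum (budget_exit_times y beta) t].

Definition total_cost (a y : R -> 'rV[R]_n) (T : R) : \bar R :=
  ((\int[mu]_(s in `[0, T]) (K P (y s) (a s)))%:E + q P (y T))%E.

Definition w (x : 'rV[R]_n) (b : R) : \bar R :=
  ereal_inf [set c | exists a y beta t T,
    [/\ feasible x b a y beta t, is_minimum (exit_times y) T &
        c = total_cost a y T]].

(* w1 is meant for x in U and 0 < b <= B, w2 for x in S. *)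
Definition w1 (x : 'rV[R]_n) (b : R) : \bar R := w x b.
Definition w2 (x : 'rV[R]_n) : \bar R := w x (B P).

Definition reachable_safe_set : set 'rV[R]_n :=
  [set x | S P x /\ (w2 x < +oo)%E].

End ValueFunction.

(* Main.v *)
Require Import Defs.
From mathcomp Require Import all_boot all_order all_algebra.
From mathcomp Require Import all_classical all_reals all_analysis.
From mathcomp Require Import measurable_realfun ring lra.
Import Order.TTheory GRing.Theory Num.Theory.
Import numFieldNormedType.Exports.

Set Implicit Arguments.
Unset Strict Implicit.
Unset Printing Implicit Defensive.

Local Open Scope classical_set_scope.
Local Open Scope ring_scope.

(** The point [x] lies in [Omega] and is safe, because the safe set is closed.
    Near [x] any two distinct points [x0], [x1] are joined by a controlled path
    inside [Omega] of duration at most [C * `|x1 - x0|] ([steer]); it spends an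
    amount of running cost and of budget proportional to that distance.  So let
    [x'] be an unsafe point close to [x].

    - Starting from [x'] with budget [b], the transfer to [x] is feasible, and on
      arrival the budget is reset to [B P]: every run from [x] can be appended,
      and [w1 P x' b <= w2 P x + O(`|x - x'|)].
    - Starting from [x] with budget [B P], the transfer to [x'] leaves a budget of
      at least [b], as [b < B P]: every run from [(x', b)] can be appended, and
      [w2 P x <= w1 P x' b + O(`|x - x'|)].

    Both are instances of [w_splice], and squeezing gives the limit.  The two
    inequalities hold in the extended reals, so infinite values need no separate
    discussion.

    For [w_splice], the budget is first eliminated ([budget_okP]): a nonnegative
    budget along a path exists if and only if every stretch of unsafe times
    consumes at most what was available at its start.  This condition is monotone
    in the initial budget and can be checked piecewise on a concatenation.

    For [steer], moving along the segment from [x0] to [x1] would require a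
    measurable selection of controls and a change of time.  Instead the control is
    frozen: at [z], take the control whose velocity points to [x1] and keep it for
    the time after which this velocity would lead to [x1].  Such a path exists by
    Picard iteration ([picard_solution]).  The dynamics being Lipschitz, it misses
    the target by an amount quadratic in the distance, so a step at least halves
    a small distance ([exists_halving_step]).  The durations decrease
    geometrically as well: infinitely many steps take a finite time linear in the
    initial distance, and their concatenation ends exactly at [x1]
    ([steer_concatenation]).  Its control is piecewise constant with countably
    many pieces, hence measurable. *)

(** * Integrals of bounded measurable functions over segments *)

Section Integral.
Context {R : realType}.
Notation mu := (@lebesgue_measure R).
Implicit Types (g : R -> R) (a b c : R).

(** On a segment this gives integrability, and it is easier to transfer to
    subsegments, translates and concatenations. *)
Definition bounded_measurable (D : set R) g : Prop :=
  measurable_fun D g /\ exists M, forall t, D t -> `|g t| <= M.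

Lemma bounded_measurable_integrable a b g :
  bounded_measurable `[a, b] g -> mu.-integrable `[a, b] (EFin \o g).
Proof.
move=> [mg [M gM]]; apply: measurable_bounded_integrable => //.
- by rewrite /= lebesgue_measure_itv /=; case: ifPn => // _; rewrite -EFinD ltry.
- by exists M; split; [exact: num_real|move=> m Mm t tD /=; exact: le_trans (gM _ tD) (ltW Mm)].
Qed.

Lemma bounded_measurableS D D' g : measurable D -> D' `<=` D ->
  bounded_measurable D g -> bounded_measurable D' g.
Proof.
move=> mD sD [mg [M gM]]; split; first exact: measurable_funS mg.
by exists M => t /sD; exact: gM.
Qed.

Lemma bounded_measurable_subitv a b c d g : a <= c -> d <= b ->
  bounded_measurable `[a, b] g -> bounded_measurable `[c, d] g.
Proof.
move=> ac db; apply: bounded_measurableS => // t /=; rewrite !in_itv /=.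
by case/andP=> ct td; rewrite (le_trans ac ct) (le_trans td db).
Qed.

(** The budget rate is only controlled where the path is unsafe, and a stretch
    of unsafe times may start at a safe one: the value at the left endpoint is
    then arbitrary, which a null set does not see. *)
Lemma bounded_measurable_closed_itv a b g :
  bounded_measurable `]a, b] g -> bounded_measurable `[a, b] g.
Proof.
move=> [mg [M gM]].
have [ab|ba] := leP a b; last first.
  rewrite set_itv_ge -?ltNge ?bnd_simp//.
  by split; [exact: measurable_fun_set0|exists 0].
rewrite (_ : `[a, b]%classic = [set a] `|` `]a, b]%classic); last first.
  by rewrite setU1itv.
split.
  apply/measurable_funU => //; split => //; exact: measurable_fun_set1.
exists (Num.max M `|g a|) => t [->|/gM h]; rewrite le_max ?lexx ?orbT//.
by rewrite h.
Qed.

Lemma int_point a g : \int[mu]_(t in `[a, a]) g t = 0.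
Proof. by rewrite set_itv1 Rintegral_set1. Qed.

Lemma int_split a b c g : a <= c -> c <= b -> bounded_measurable `[a, b] g ->
  \int[mu]_(t in `[a, b]) g t =
  \int[mu]_(t in `[a, c]) g t + \int[mu]_(t in `[c, b]) g t.
Proof.
move=> ac cb bg.
have := @Rintegral_itvB R g (BLeft a) (BRight b) c
  (bounded_measurable_integrable bg).
rewrite !bnd_simp => /(_ ac cb).
rewrite Rintegral_itv_obnd_cbnd; last first.
  have := bounded_measurable_integrable (bounded_measurable_subitv ac (lexx b) bg).
  by apply: integrableS => //; apply: subset_itvr; rewrite bnd_simp.
by move=> <-; rewrite addrC subrK.
Qed.

Lemma int_le a b M g : a <= b -> bounded_measurable `[a, b] g ->
  (forall t, a <= t <= b -> g t <= M) ->
  \int[mu]_(t in `[a, b]) g t <= M * (b - a).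
Proof.
move=> ab bg gM.
apply: (@le_trans _ _ (\int[mu]_(t in `[a, b]) M)).
  apply: le_Rintegral => //; first exact: bounded_measurable_integrable.
  apply: bounded_measurable_integrable; split=> //.
  by exists `|M|.
rewrite Rintegral_cst//= lebesgue_measure_itv /= lte_fin.
by case: ltgtP ab => // -> _; rewrite subrr.
Qed.

Lemma norm_int_le a b M g : a <= b -> bounded_measurable `[a, b] g ->
  (forall t, a <= t <= b -> `|g t| <= M) ->
  `|\int[mu]_(t in `[a, b]) g t| <= M * (b - a).
Proof.
move=> ab bg gM.
have ig := bounded_measurable_integrable bg.
apply: le_trans (le_normr_Rintegral _ ig) _ => //.
apply: int_le => //; split; last by exists M => t /=; rewrite in_itv /= normr_id => /gM.
by apply: measurableT_comp => //; case: bg.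
Qed.

(** The bound may fail at the left endpoint: see
    [bounded_measurable_closed_itv]. *)
Lemma int_le_open a b M g : a <= b -> bounded_measurable `]a, b] g ->
  (forall t, a < t <= b -> g t <= M) ->
  \int[mu]_(t in `[a, b]) g t <= M * (b - a).
Proof.
move=> ab bg gM.
have bg' := bounded_measurable_closed_itv bg.
(* [h] agrees with [g] almost everywhere and satisfies the bound everywhere *)
pose h t := if t == a then M else g t.
have hg : {in `]a, b]%classic, g =1 h}.
  move=> t; rewrite inE /= in_itv /= => /andP[at_ _].
  by rewrite /h gt_eqF.
have bh : bounded_measurable `[a, b] h.
  apply: bounded_measurable_closed_itv; case: bg => mg [N gN]; split.
    exact: eq_measurable_fun hg mg.
  by exists N => t tD; rewrite -hg ?inE//; exact: gN.
rewrite -Rintegral_itv_obnd_cbnd; last first.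
  apply: integrableS (bounded_measurable_integrable bg') => //.
  by apply: subset_itvr; rewrite bnd_simp.
have -> : \int[mu]_(t in `]a, b]) g t = \int[mu]_(t in `]a, b]) h t.
  exact: eq_Rintegral.
rewrite Rintegral_itv_obnd_cbnd; last first.
  apply: integrableS (bounded_measurable_integrable bh) => //.
  by apply: subset_itvr; rewrite bnd_simp.
apply: int_le => // t /andP[at_ tb]; rewrite /h; case: eqP => // /eqP ta.
by apply: gM; rewrite tb andbT lt_neqAle eq_sym ta.
Qed.

Lemma eq_int a b g h : (forall t, a <= t <= b -> g t = h t) ->
  \int[mu]_(t in `[a, b]) g t = \int[mu]_(t in `[a, b]) h t.
Proof.
by move=> gh; apply: eq_Rintegral => t; rewrite inE /= in_itv /=; exact: gh.
Qed.

Lemma measurable_subr c :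
  measurable_fun [set: R] (fun t => t - c : measurableTypeR R).
Proof. exact: measurable_realfun.measurable_funB. Qed.

Lemma measurable_fun_shift c D g : measurable D -> measurable_fun D g ->
  measurable_fun [set t | D (t - c)] (fun t => g (t - c)).
Proof.
move=> mD mg.
have ms := measurable_subr c.
by apply: (measurable_comp mD _ mg (measurable_funTS ms)) => _ [t Dt <-].
Qed.

Lemma measurable_preimage_subr c (D : set R) : measurable D ->
  measurable [set t | D (t - c)].
Proof.
move=> mD.
have ms := measurable_subr c.
by rewrite -[X in measurable X]setTI; apply: ms.
Qed.

Lemma lebesgue_measure_shift c (X : set R) : measurable X ->
  pushforward mu (fun t => t - c : measurableTypeR R) X = mu X.
Proof.
have ms := measurable_subr c.
move=> mX; apply/esym/lebesgue_measure_unique => //= _ [[a b]] _ <-.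
rewrite /pushforward /=.
rewrite (_ : _ @^-1` _ = `]a + c, b + c]%classic); last first.
  by apply/seteqP; split => t /=; rewrite !in_itv /= ltrBrDr lerBlDr.
rewrite !lebesgue_measure_itv /= !lte_fin ltrD2r.
by case: ifP => // _; rewrite -!EFinD; congr (_%:E); ring.
Qed.

Lemma bounded_measurable_shift c a b g : bounded_measurable `[a, b] g ->
  bounded_measurable `[a + c, b + c] (fun t => g (t - c)).
Proof.
move=> [mg [M gM]].
have e : [set t | `[a, b]%classic (t - c)] = `[a + c, b + c]%classic.
  by apply/seteqP; split => t /=; rewrite !in_itv /= lerBrDr lerBlDr.
split; first by rewrite -e; exact: measurable_fun_shift.
by exists M => t; rewrite -e; exact: gM.
Qed.

(** Lebesgue measure is invariant under translations
    ([lebesgue_measure_shift]), so this is a change of variables along the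
    pushforward measure. *)
Lemma int_shift c a b g : bounded_measurable `[a, b] g ->
  \int[mu]_(t in `[a + c, b + c]) g (t - c) = \int[mu]_(t in `[a, b]) g t.
Proof.
move=> bg.
have e : (fun t => t - c : measurableTypeR R) @^-1` `[a, b]%classic =
    `[a + c, b + c]%classic.
  by apply/seteqP; split => t /=; rewrite !in_itv /= lerBrDr lerBlDr.
(* the change of variables needs measurability on the whole line *)
pose h := g \_ `[a, b].
have hg : {in `[a, b]%classic, g =1 h}.
  by move=> t tD; rewrite /h /patch tD.
have mh : measurable_fun [set: R] h.
  by apply/(measurable_restrictT _ _).1 => //; case: bg.
have bh : bounded_measurable `[a, b] h.
  split; first exact: measurable_funTS.
  case: bg => _ [M gM]; exists M => t tD.
  by rewrite -hg ?inE//; exact: gM.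
transitivity (\int[mu]_(t in `[a, b]) h t); last by apply: eq_Rintegral => t tD; rewrite hg.
transitivity (\int[mu]_(t in `[a + c, b + c]) h (t - c)).
  apply: eq_int => t /andP[h1 h2]; rewrite hg// inE /= in_itv /=.
  by rewrite lerBrDr lerBlDr h1 h2.
rewrite /Rintegral; congr fine.
have ms := measurable_subr c.
have := @integral_pushforward _ _ (measurableTypeR R) (measurableTypeR R) R _ ms
  mu `[a, b]%classic (EFin \o h).
rewrite e => <- //; last 2 first.
- exact/measurable_realfun.measurable_EFinP.
- exact: (bounded_measurable_integrable (bounded_measurable_shift c bh)).
apply: eq_measure_integral => X mX _; exact: lebesgue_measure_shift.
Qed.

End Integral.

(** * Measurability of Lipschitz functions of measurable curves *)

Section RowVectors.
Context {R : realType}.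

Lemma norm_coord_le n (v : 'rV[R]_n) i : `|v ord0 i| <= `|v|.
Proof.
rewrite [leRHS]/Num.Def.normr /= mx_normrE; apply/bigmax_geP; right => /=.
by exists (ord0, i).
Qed.

Lemma norm_leP n (v : 'rV[R]_n) e : 0 <= e ->
  (forall i, `|v ord0 i| <= e) -> `|v| <= e.
Proof.
move=> e0 ve; rewrite [leLHS]/Num.Def.normr /= mx_normrE; apply/bigmax_leP; split=> //.
by case=> i j _ /=; rewrite (ord1 i).
Qed.

Lemma norm_ltP n (v : 'rV[R]_n) e : 0 < e ->
  (forall i, `|v ord0 i| < e) -> `|v| < e.
Proof.
move=> e0 ve; rewrite [ltLHS]/Num.Def.normr /= mx_normrE; apply/bigmax_ltP; split=> //.
by case=> i j _ /=; rewrite (ord1 i).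
Qed.

Lemma rat_approx n (v : 'rV[R]_n) (e : R) : 0 < e ->
  exists r : 'rV[rat]_n, `|v - map_mx ratr r| < e.
Proof.
move=> e0.
have approx i : exists r : rat, `|v ord0 i - ratr r| < e.
  have [r] := @rat_in_itvoo R (v ord0 i - e) (v ord0 i + e) ltac:(lra).
  rewrite in_itv /= => /andP[h1 h2]; exists r; rewrite ltr_norml; lra.
have [r rP] := choice approx.
by exists (\row_i r i); apply: norm_ltP => // i; rewrite !mxE.
Qed.

Lemma measurable_near n (D : set R) (y : R -> 'rV[R]_n) (p : 'rV[R]_n) e :
  measurable D -> 0 < e ->
  (forall i, measurable_fun D (fun t => y t ord0 i)) ->
  measurable (D `&` [set t | `|y t - p| < e]).
Proof.
move=> mD e0 my.
rewrite (_ : _ `&` _ = D `&`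
  \bigcap_(i in [set: 'I_n]) (D `&` [set t | `|y t ord0 i - p ord0 i| < e])).
  apply: measurableI => //; apply: fin_bigcap_measurable => // i _.
  have mf : measurable_fun D (fun t => `|y t ord0 i - p ord0 i|).
    apply: measurableT_comp => //; apply: measurable_funB => //.
  have := mf mD `]-oo, e[%classic (measurable_itv _).
  congr (measurable _); apply/seteqP; split => t /=; rewrite in_itv //=.
apply/seteqP; split => t /= [Dt h]; split => //.
  move=> i _; split => //; apply: le_lt_trans h.
  by have := norm_coord_le (y t - p) i; rewrite !mxE.
by apply: norm_ltP => // i; rewrite !mxE; have [] := h i I.
Qed.

(** A sublevel set [G < c] of the composite is a countable union: over the balls
    with rational centre and radius [1 / k.+1] on which [G < c] holds at all
    points of [E], of the times at which the curve lies in the ball. *)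
Lemma measurable_lipschitz_comp n m (E : set ('rV[R]_n * 'rV[R]_m))
    (G : 'rV[R]_n -> 'rV[R]_m -> R) (L : R) (D : set R)
    (y : R -> 'rV[R]_n) (a : R -> 'rV[R]_m) :
  (forall z z', E z -> E z' -> `|G z.1 z.2 - G z'.1 z'.2| <= L * `|z - z'|) ->
  measurable D ->
  (forall i, measurable_fun D (fun t => y t ord0 i)) ->
  (forall i, measurable_fun D (fun t => a t ord0 i)) ->
  (forall t, D t -> E (y t, a t)) ->
  measurable_fun D (fun t => G (y t) (a t)).
Proof.
move=> GL mD my ma DE _; apply: (measurability _ (RGenInftyO.measurableE R)) => //.
move=> _ [_ [c ->] <-].
pose inside (k : 'rV[rat]_n * 'rV[rat]_m * nat) (z : 'rV[R]_n * 'rV[R]_m) :=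
  `|z.1 - map_mx ratr k.1.1| < k.2.+1%:R^-1 /\
  `|z.2 - map_mx ratr k.1.2| < k.2.+1%:R^-1.
pose good k := forall z, E z -> inside k z -> G z.1 z.2 < c.
rewrite (_ : _ `&` _ = \bigcup_k
  (if `[< good k >] then D `&` [set t | inside k (y t, a t)] else set0)).
  apply: countable_bigcupT_measurable => [|k]; first exact: countableP.
  case: ifP => // _.
  rewrite (_ : _ `&` _ =
    (D `&` [set t | `|y t - map_mx ratr k.1.1| < k.2.+1%:R^-1]) `&`
    (D `&` [set t | `|a t - map_mx ratr k.1.2| < k.2.+1%:R^-1])).
    by apply: measurableI; exact: measurable_near.
  by apply/seteqP; split => t /=; [case=> ? []|case=> -[? ?] []].
apply/seteqP; split => t /=; last first.
  case=> k _; case: ifP => // /asboolP gk [Dt ik]; split => //.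
  by rewrite in_itv /=; exact: (gk (y t, a t)) (DE _ Dt) ik.
rewrite in_itv /= => -[Dt Gc].
have L1 : 0 < `|L| + 1 by rewrite ltr_wpDl.
pose e := (c - G (y t) (a t)) / (`|L| + 1).
have e0 : 0 < e by rewrite divr_gt0// subr_gt0.
have [N] : exists N : nat, N.+1%:R^-1 < e / 2.
  have [N NP] := ltr_add_invr (divr_gt0 e0 (ltr0n R 2)).
  exists N; move: NP; rewrite add0r//.
move=> Ne.
have N0 : 0 < N.+1%:R^-1 :> R by rewrite invr_gt0.
have [r1 r1P] := rat_approx (y t) N0.
have [r2 r2P] := rat_approx (a t) N0.
exists (r1, r2, N) => //=.
case: asboolP => [_|]; first by split.
case=> -[z1 z2] Ez [/= i1 i2].
have := GL (z1, z2) (y t, a t) Ez (DE _ Dt) => /=.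
have zN : `|(z1, z2) - (y t, a t)| < e.
  rewrite prod_normE gt_max /=.
  by apply/andP; split; [apply: le_lt_trans (ler_distD (map_mx ratr r1) _ _) _|
    apply: le_lt_trans (ler_distD (map_mx ratr r2) _ _) _];
    rewrite [ltRHS]splitr; apply: ltrD; rewrite 1?(distrC (map_mx _ _));
    apply: lt_trans Ne.
move=> GLz.
have : `|G z1 z2 - G (y t) (a t)| < c - G (y t) (a t).
  apply: le_lt_trans GLz _.
  apply: (@le_lt_trans _ _ ((`|L| + 1) * `|(z1, z2) - (y t, a t)|)).
    by rewrite ler_wpM2r// (le_trans (ler_norm _))// lerDl.
  by rewrite -lter_pdivlMl// mulrC.
by move/(le_lt_trans (ler_norm _)); lra.
Qed.

End RowVectors.

(** * Concatenation of functions and integral equations *)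

(** At the junction the first function is followed; with the same convention for
    controls, paths and integrands, splicing commutes with pointwise operations
    ([splice_map]). *)
Definition splice {R : realType} {T : Type} (t1 : R) (g1 g2 : R -> T) (s : R) : T :=
  if s <= t1 then g1 s else g2 (s - t1).

Section Splice.
Context {R : realType}.
Notation mu := (@lebesgue_measure R).

Lemma splice_right T (t1 : R) (g1 g2 : R -> T) u : 0 < u ->
  splice t1 g1 g2 (t1 + u) = g2 u.
Proof. by move=> u0; rewrite /splice leNgt ltrDl u0 /= addrAC subrr add0r. Qed.

Lemma splice_map T T' T'' (h : T -> T' -> T'') (t1 : R) f1 f2 g1 g2 u :
  h (splice t1 f1 f2 u) (splice t1 g1 g2 u) =
  splice t1 (fun u => h (f1 u) (g1 u)) (fun u => h (f2 u) (g2 u)) u.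
Proof. by rewrite /splice; case: ifP. Qed.

Lemma measurable_splice (t1 : R) (D D1 D2 : set R) (g1 g2 : R -> R) :
  measurable D -> measurable D1 -> measurable D2 ->
  (forall u, D u -> u <= t1 -> D1 u) ->
  (forall u, D u -> t1 < u -> D2 (u - t1)) ->
  measurable_fun D1 g1 -> measurable_fun D2 g2 ->
  measurable_fun D (splice t1 g1 g2).
Proof.
move=> mD mD1 mD2 h1 h2 m1 m2.
have m : measurable_fun D (fun u : R => u <= t1).
  by apply: measurable_fun_ler => //; exact: measurable_id.
apply: measurable_fun_if => //.
- apply: measurable_funS m1 => // u [Du /=]; exact: h1.
- apply: (measurable_funS (measurable_preimage_subr t1 mD2)); last exact: measurable_fun_shift.
  by move=> u [Du /=] /negbT; rewrite -ltNge; exact: h2.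
Qed.

Lemma bounded_measurable_splice (t1 a b : R) (g1 g2 : R -> R) :
  bounded_measurable `[a, t1] g1 -> bounded_measurable `[0, b] g2 ->
  bounded_measurable `[a, t1 + b] (splice t1 g1 g2).
Proof.
move=> [m1 [M1 b1]] [m2 [M2 b2]].
have h1 u : `[a, t1 + b]%classic u -> u <= t1 -> `[a, t1]%classic u.
  by rewrite /= !in_itv /= => /andP[-> _] ->.
have h2 u : `[a, t1 + b]%classic u -> t1 < u -> `[0, b]%classic (u - t1).
  by rewrite /= !in_itv /= => /andP[_ h] tu; apply/andP; split; lra.
split; first exact: measurable_splice m1 m2.
exists (Num.max M1 M2) => u Du; rewrite le_max /splice.
case: (leP u t1) => tu; first by rewrite b1//; exact: h1.
by rewrite b2 ?orbT//; exact: h2.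
Qed.

Lemma int_splice_left (t1 a b : R) (g1 g2 : R -> R) : b <= t1 ->
  \int[mu]_(u in `[a, b]) splice t1 g1 g2 u = \int[mu]_(u in `[a, b]) g1 u.
Proof.
by move=> bt; apply: eq_int => u /andP[_ ub]; rewrite /splice (le_trans ub bt).
Qed.

Lemma int_splice_right (t1 a b : R) (g1 g2 : R -> R) : 0 <= a -> a <= b ->
  bounded_measurable `[a, b] g2 ->
  \int[mu]_(u in `[t1 + a, t1 + b]) splice t1 g1 g2 u =
  \int[mu]_(u in `[a, b]) g2 u.
Proof.
move=> a0 ab bg.
rewrite -(int_shift t1 bg) ![_ + t1]addrC.
have bs := bounded_measurable_shift t1 bg; rewrite ![_ + t1]addrC in bs.
have e : {in `]t1 + a, t1 + b]%classic, splice t1 g1 g2 =1 (fun u => g2 (u - t1))}.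
  move=> u; rewrite inE /= in_itv /= => /andP[h _].
  by rewrite /splice leNgt (le_lt_trans _ h)// lerDl.
have bo : bounded_measurable `]t1 + a, t1 + b] (fun u => g2 (u - t1)).
  by apply: bounded_measurableS bs => //; apply: subset_itvr; rewrite bnd_simp.
have bo' : bounded_measurable `]t1 + a, t1 + b] (splice t1 g1 g2).
  case: bo => m [M bM]; split.
    by apply: eq_measurable_fun m => u uD; rewrite e.
  by exists M => u uD; rewrite e ?inE//; exact: bM.
rewrite -Rintegral_itv_obnd_cbnd; last first.
  apply: integrableS (bounded_measurable_integrable (bounded_measurable_closed_itv bo')) => //.
  by apply: subset_itvr; rewrite bnd_simp.
rewrite -[RHS]Rintegral_itv_obnd_cbnd; last first.
  apply: integrableS (bounded_measurable_integrable bs) => //.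
  by apply: subset_itvr; rewrite bnd_simp.
exact: eq_Rintegral.
Qed.

Lemma int_splice (t1 a b : R) (g1 g2 : R -> R) : a <= t1 -> 0 <= b ->
  bounded_measurable `[a, t1] g1 -> bounded_measurable `[0, b] g2 ->
  \int[mu]_(u in `[a, t1 + b]) splice t1 g1 g2 u =
  \int[mu]_(u in `[a, t1]) g1 u + \int[mu]_(u in `[0, b]) g2 u.
Proof.
move=> at1 b0 b1 b2; have tb : t1 <= t1 + b by rewrite lerDl.
rewrite (int_split at1 tb); last exact: bounded_measurable_splice.
rewrite int_splice_left//; congr (_ + _).
by rewrite -(int_splice_right t1 g1 (lexx 0) b0 b2) addr0.
Qed.

(** A curve given by an integral equation is Lipschitz with the bound of the
    integrand as constant, so its continuity comes for free. *)
Lemma integral_equation_lipschitz n (t M : R) (g : 'I_n -> R -> R)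
    (x : 'rV[R]_n) (y : R -> 'rV[R]_n) :
  0 <= M ->
  (forall i, measurable_fun `[0, t] (g i)) ->
  (forall i u, 0 <= u <= t -> `|g i u| <= M) ->
  (forall s i, 0 <= s <= t ->
     y s ord0 i = x ord0 i + \int[mu]_(r in `[0, s]) g i r) ->
  forall s r, 0 <= s <= t -> 0 <= r <= t -> `|y s - y r| <= M * `|s - r|.
Proof.
move=> M0 mg gM yE.
have bm i : bounded_measurable `[0, t] (g i).
  by split => //; exists M => u /=; rewrite in_itv /=; exact: gM.
wlog sr : / forall s r, s <= r -> 0 <= s <= t -> 0 <= r <= t ->
    `|y s - y r| <= M * `|s - r|.
  move=> W; apply: (W) => {W} s r sr /andP[s0 st] /andP[r0 rt].
  rewrite distrC [`|s - r|]distrC (ger0_norm (_ : 0 <= r - s)) ?subr_ge0//.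
  apply: norm_leP => [|i]; first by rewrite mulr_ge0// subr_ge0.
  rewrite !mxE !yE ?s0 ?r0//.
  rewrite (@int_split _ 0 r s)//; last first.
    exact: bounded_measurable_subitv (lexx _) rt (bm i).
  rewrite (_ : _ - _ = \int[mu]_(u in `[s, r]) g i u); last by ring.
  apply: norm_int_le => //; first exact: bounded_measurable_subitv (bm i).
  by move=> u /andP[su ur]; apply: gM; rewrite (le_trans s0 su) (le_trans ur rt).
move=> s r hs hr; have [|/ltW] := leP s r => h; first exact: sr.
by rewrite distrC (distrC s); exact: sr.
Qed.

Lemma lipschitz_within_continuous n (t M : R) (y : R -> 'rV[R]_n) :
  (forall s r, 0 <= s <= t -> 0 <= r <= t -> `|y s - y r| <= M * `|s - r|) ->
  {within `[0, t], continuous y}.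
Proof.
move=> yM; apply/subspace_continuousP => s sD.
have hs : 0 <= s <= t by move: sD; rewrite /= in_itv.
apply/cvgrPdist_lt => e e0.
have M1 : 0 < `|M| + 1 by rewrite ltr_wpDl.
near=> r.
have hr : 0 <= r <= t.
  have : r \in `[0, t] by near: r; exact: withinT.
  by rewrite in_itv.
apply: le_lt_trans (yM _ _ hs hr) _.
apply: (@le_lt_trans _ _ ((`|M| + 1) * `|s - r|)).
  by rewrite ler_wpM2r// (le_trans (ler_norm _))// lerDl.
rewrite mulrC -ltr_pdivlMr//.
near: r; rewrite near_withinE; near=> r => _.
by near: r; apply: nbhsx_ballx; exact: divr_gt0.
Unshelve. all: by end_near.
Qed.

End Splice.

(** * The data along a path, and elimination of the budget *)

Section Problem.
Context {R : realType} {n : nat}.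
Variable P : budget_reset_problem R n.
Hypothesis HP : standing_assumptions P.
Notation mu := (@lebesgue_measure R).
Notation V := ('rV[R]_n).

Lemma lipschitz_pairP (W : normedModType R) (D E : set V) (G : V -> V -> W) :
  [lipschitz G z.1 z.2 | z in D `*` E] ->
  exists2 L : R, 0 < L & forall z z', (D `*` E) z -> (D `*` E) z' ->
    `|G z.1 z.2 - G z'.1 z'.2| <= L * `|z - z'|.
Proof.
move=> [M [_ MP]]; exists (`|M| + 1); first by rewrite ltr_wpDl.
move=> z z' Dz Dz'.
have := MP (`|M| + 1); rewrite (le_lt_trans (ler_norm M)) ?ltrDl// => /(_ isT).
by move=> /(_ (z, z')) /=; apply.
Qed.

Lemma enorm_ge0 (v : V) : 0 <= enorm v. Proof. exact: sqrtr_ge0. Qed.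

Lemma enorm_sqr (v : V) : enorm v ^+ 2 = dotv v v.
Proof. by rewrite sqr_sqrtr// sumr_ge0// => i _; rewrite -expr2 sqr_ge0. Qed.

Lemma coord_le_enorm (v : V) i : `|v ord0 i| <= enorm v.
Proof.
rewrite -ler_sqr ?nnegrE ?enorm_ge0// enorm_sqr /dotv (bigD1 i)//= -expr2.
rewrite real_normK ?num_real// lerDl sumr_ge0// => j _.
by rewrite -expr2 sqr_ge0.
Qed.

Lemma norm_le_enorm (v : V) : `|v| <= enorm v.
Proof. by apply: norm_leP; [exact: enorm_ge0|exact: coord_le_enorm]. Qed.

Lemma enorm_le (v : V) : enorm v <= n%:R * `|v|.
Proof.
rewrite -ler_sqr ?nnegrE ?enorm_ge0 ?mulr_ge0// enorm_sqr.
apply: (@le_trans _ _ (n%:R * `|v| ^+ 2)).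
  apply: (@le_trans _ _ (\sum_(i < n) `|v| ^+ 2)); last first.
    by rewrite sumr_const card_ord mulr_natl.
  apply: ler_sum => i _; rewrite -expr2 -[_ ^+ 2]ger0_norm ?sqr_ge0// normrX.
  by rewrite ler_sqr ?nnegrE// norm_coord_le.
rewrite exprMn ler_wpM2r ?sqr_ge0// -natrX ler_nat.
by case: n => // k; rewrite -[X in (X <= _)%N]expn1 leq_pexp2l.
Qed.

Lemma speed_bound : exists2 F2 : R, 0 < F2 &
  forall x a, closure (Omega P) x -> A P a -> `|f P x a| <= F2.
Proof.
have [F1 [F2 [F10 HF2 _]]] := Controllability HP.
exists (`|F2| + 1); first by rewrite ltr_wpDl.
move=> x a xO Aa; apply: le_trans (norm_le_enorm _) _.
by rewrite (le_trans (HF2 _ _ xO Aa))// (le_trans (ler_norm _))// lerDl.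
Qed.

Lemma cost_bound : exists2 K2 : R, 0 < K2 &
  forall x a, closure (Omega P) x -> A P a -> 0 <= K P x a <= K2.
Proof.
have [K1 [K2 [K10 HK]]] := Running_cost HP.
exists (`|K2| + 1); first by rewrite ltr_wpDl.
move=> x a xO Aa; have /andP[h1 h2] := HK _ _ xO Aa.
have := ler_norm K2; lra.
Qed.

Lemma rate_bound : exists2 k2 : R, 0 < k2 &
  forall x a, U P x -> A P a -> 0 <= Khat P x a <= k2.
Proof.
have [_ [K1 [K2 [K10 HK]]]] := Budget_rate HP.
exists (`|K2| + 1); first by rewrite ltr_wpDl.
move=> x a xO Aa; have /andP[h1 h2] := HK _ _ xO Aa.
have := ler_norm K2; lra.
Qed.

Lemma safe_or_unsafe x : closure (Omega P) x -> U P x \/ S P x.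
Proof. by have [<- _ _ _ _] := Splitting HP. Qed.

Lemma safe_unsafe_disjoint x : U P x -> S P x -> False.
Proof.
have [_ US _ _ _] := Splitting HP.
by move=> Ux Sx; have : (U P `&` S P) x by []; rewrite US.
Qed.

Lemma unsafe_open : open (U P). Proof. by have [_ _ ? _ _] := Splitting HP. Qed.

Lemma safe_closed : closed (S P).
Proof.
have -> : S P = closure (Omega P) `&` ~` U P.
  apply/seteqP; split => x.
    move=> Sx; split; last by move=> /safe_unsafe_disjoint; apply.
    by have [<- _ _ _ _] := Splitting HP; right.
  by move=> [/safe_or_unsafe[]].
apply: closedI; first exact: closed_closure.
by rewrite closedC; exact: unsafe_open.
Qed.

Lemma path_measurable x a t y : is_path P x a t y ->
  forall i, measurable_fun `[0, t] (fun s => y s ord0 i).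
Proof.
move=> [cy _ _] i; apply: subspace_continuous_measurable_fun => //.
move=> s; apply: (@continuous_comp _ _ _ (y : subspace _ -> V) (fun v : V => v ord0 i) s).
  exact: cy.
exact: coord_continuous.
Qed.

Lemma admissible_measurable a (s t : R) : admissible P a -> 0 <= s ->
  forall i, measurable_fun `[s, t] (fun u => a u ord0 i).
Proof.
move=> [_ ma] s0 i; apply: measurable_funS (ma i) => // u /=.
by rewrite !in_itv /= andbT => /andP[/(le_trans s0)].
Qed.

(** What is needed to integrate the data along a control and a curve.  Unlike
    [is_path] it does not involve the dynamics, so that it can be established
    for a concatenated curve before the integral equation is. *)
Definition curve (a y : R -> V) (t : R) : Prop :=
  [/\ forall s, 0 <= s <= t -> closure (Omega P) (y s),
      forall s, 0 <= s <= t -> A P (a s),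
      forall i, measurable_fun `[0, t] (fun s => y s ord0 i) &
      forall i, measurable_fun `[0, t] (fun s => a s ord0 i)].

Lemma path_curve x a t y : admissible P a -> is_path P x a t y -> curve a y t.
Proof.
move=> aa py; split.
- by case: py.
- by move=> s /andP[s0 _]; case: aa => aA _; exact: aA.
- exact: path_measurable py.
- exact: admissible_measurable.
Qed.

Lemma curve_f a y t i : curve a y t ->
  bounded_measurable `[0, t] (fun s => f P (y s) (a s) ord0 i).
Proof.
move=> [yO aA my ma]; split.
  have [/lipschitz_pairP[L L0 LP] _] := Lipschitz_data HP.
  apply: (@measurable_lipschitz_comp _ _ _ (closure (Omega P) `*` A P)
    (fun p q => f P p q ord0 i) L _ y a) => //.
    move=> z z' Ez Ez'; apply: le_trans (LP _ _ Ez Ez').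
    by have := norm_coord_le (f P z.1 z.2 - f P z'.1 z'.2) i; rewrite !mxE.
  by move=> s /=; rewrite in_itv /= => st; split; [exact: yO|exact: aA].
have [F2 F20 FP] := speed_bound; exists F2 => s /=; rewrite in_itv /= => st.
by apply: le_trans (norm_coord_le _ _) _; apply: FP; [exact: yO|exact: aA].
Qed.

Lemma curve_K a y t : curve a y t ->
  bounded_measurable `[0, t] (fun s => K P (y s) (a s)).
Proof.
move=> [yO aA my ma]; split.
  have [_ /lipschitz_pairP[L L0 LP]] := Lipschitz_data HP.
  apply: (@measurable_lipschitz_comp _ _ _ (closure (Omega P) `*` A P)
    (K P) L _ y a) => //.
  by move=> s /=; rewrite in_itv /= => st; split; [exact: yO|exact: aA].
have [K2 K20 KP] := cost_bound; exists K2 => s /=; rewrite in_itv /= => st.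
by have /andP[? ?] := KP _ _ (yO _ st) (aA _ st); rewrite ger0_norm.
Qed.

Lemma curve_Khat a y t s r : curve a y t -> 0 <= s -> r <= t ->
  (forall u, s < u <= r -> U P (y u)) ->
  bounded_measurable `[s, r] (fun s => Khat P (y s) (a s)).
Proof.
move=> [yO aA my ma] s0 rt Uy; apply: bounded_measurable_closed_itv.
have sub : `]s, r]%classic `<=` `[0, t]%classic.
  move=> u /=; rewrite !in_itv /= => /andP[su ur].
  by rewrite (le_trans s0 (ltW su)) (le_trans ur rt).
split.
  have [/lipschitz_pairP[L L0 LP] _] := Budget_rate HP.
  apply: (@measurable_lipschitz_comp _ _ _ (U P `*` A P) (Khat P) L _ y a) => //.
  - by move=> i; exact: measurable_funS sub (my i).
  - by move=> i; exact: measurable_funS sub (ma i).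
  move=> u ur; split => /=; first by apply: Uy; move: ur; rewrite /= in_itv.
  by apply: aA; move/sub: ur; rewrite /= in_itv.
have [k2 k20 kP] := rate_bound; exists k2 => u ur.
have Uu : U P (y u) by apply: Uy; move: ur; rewrite /= in_itv.
have Au : A P (a u) by apply: aA; move/sub: ur; rewrite /= in_itv.
by have /andP[? ?] := kP _ _ Uu Au; rewrite ger0_norm.
Qed.

Lemma int_Khat_le k2 a y t s r :
  (forall x a, U P x -> A P a -> 0 <= Khat P x a <= k2) ->
  curve a y t -> 0 <= s -> s <= r -> r <= t ->
  (forall u, s < u <= r -> U P (y u)) ->
  \int[mu]_(u in `[s, r]) Khat P (y u) (a u) <= k2 * (r - s).
Proof.
move=> kP cv s0 sr rt Uy; apply: int_le_open => //.
  apply: bounded_measurableS (curve_Khat cv s0 rt Uy) => //.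
  by apply: subset_itvr; rewrite bnd_simp.
move=> u ur; have [_ aA _ _] := cv.
have Au : A P (a u) by apply: aA; lra.
by have /andP[] := kP _ _ (Uy _ ur) Au.
Qed.

(** The hybrid rule solved: a stretch of unsafe times consumes at most the budget
    available at its start, which is [B P] after a safe point and the initial
    budget [b] at time [0] in the unsafe set. *)
Definition budget_ok (b : R) (a y : R -> V) (t : R) : Prop :=
  forall s r c, 0 <= s <= r -> r <= t -> (forall u, s < u <= r -> U P (y u)) ->
    (S P (y s) /\ c = B P) \/ [/\ s = 0, U P (y 0) & c = b] ->
    \int[mu]_(u in `[s, r]) Khat P (y u) (a u) <= c.

(** The inequality over a stretch is the nonnegativity of the budget at its end.
    Conversely a budget is reconstructed from the last safe time [sup (Z s)]
    before [s]; the supremum is attained, and the path is unsafe afterwards,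
    because the unsafe set is open and the path continuous. *)
Lemma budget_okP (b : R) (a y : R -> V) (t : R) : 0 <= t -> {within `[0, t], continuous y} ->
  curve a y t ->
  (exists2 beta, is_budget P b a y t beta & forall s, 0 <= s <= t -> 0 <= beta s)
  <-> budget_ok b a y t.
Proof.
move=> t0 cy cv; have [yO _ _ _] := cv; split.
  move=> [beta [betaS beta0 betaU] beta_ge0] s r c sr rt Uy sc.
  have bs : beta s = c.
    case: sc => [[Ss ->]|[-> U0 ->]]; last exact: beta0.
    by apply: betaS => //; lra.
  have := betaU s r sr rt Uy; have := beta_ge0 r ltac:(lra); lra.
move=> ok.
pose Z s := [set u | 0 <= u <= s /\ S P (y u)].
pose beta s := if `[< Z s !=set0 >]
  then B P - \int[mu]_(u in `[sup (Z s), s]) Khat P (y u) (a u)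
  else b - \int[mu]_(u in `[0, s]) Khat P (y u) (a u).
have ZS s : 0 <= s <= t -> Z s !=set0 ->
    [/\ 0 <= sup (Z s) <= s, S P (y (sup (Z s))) &
        forall u, sup (Z s) < u <= s -> U P (y u)].
  move=> /andP[s0 st] Z0.
  have hs : has_sup (Z s) by split => //; exists s => u [/andP[]].
  have ubZ u : Z s u -> u <= sup (Z s) by move=> Zu; exact: ub_le_sup hs.2 _ Zu.
  have sup_s : sup (Z s) <= s by apply: ge_sup => // u [/andP[]].
  have sup0 : 0 <= sup (Z s).
    by have [u Zu] := Z0; apply: le_trans (ubZ u Zu); case: Zu => /andP[].
  have sup_t : 0 <= sup (Z s) <= t by rewrite sup0 (le_trans sup_s st).
  split; first by rewrite sup0 sup_s.
    have [Us|//] := safe_or_unsafe (yO _ sup_t).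
    have /subspace_continuousP/(_ (sup (Z s))) := cy.
    rewrite /= in_itv /= => /(_ sup_t).
    move=> /(_ _ (open_nbhs_nbhs (conj unsafe_open Us))).
    rewrite /nbhs /= => -[e /= e0 eP].
    have [u Zu ue] := sup_adherent e0 hs.
    have /andP[u0 us] := Zu.1.
    exfalso; apply: (@safe_unsafe_disjoint (y u)) Zu.2.
    apply: eP; rewrite /ball_ /= ?in_itv /=.
      by have uZ := ubZ _ Zu; rewrite ger0_norm ?subr_ge0//; lra.
    by rewrite u0 (le_trans us st).
  move=> u /andP[su us].
  have u0 : 0 <= u by lra.
  have [//|Su] := safe_or_unsafe (yO u ltac:(lra)).
  have : Z s u by split=> //; rewrite u0 us.
  by move=> /ubZ; lra.
have nZ s : 0 <= s <= t -> ~ (Z s !=set0) -> forall u, 0 <= u <= s -> U P (y u).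
  move=> st nZ u us; have [//|Su] := safe_or_unsafe (yO u ltac:(lra)).
  by exfalso; apply: nZ; exists u.
exists beta.
  split.
  - move=> s st Ss; rewrite /beta.
    have [Z0|Z0] := asboolP; last by exfalso; apply: Z0; exists s; split => //; lra.
    have [h1 h2 h3] := ZS s st Z0.
    suff -> : sup (Z s) = s by rewrite int_point subr0.
    apply/le_anti; rewrite andbC.
    have /andP[_ ->] := h1; rewrite andbT leNgt; apply/negP => lts.
    by apply: (@safe_unsafe_disjoint (y s)) => //; apply: h3; rewrite lts lexx.
  - move=> U0; rewrite /beta; case: asboolP => [[u [u0 Su]]|_].
      by exfalso; apply: (@safe_unsafe_disjoint (y 0)) => //; have -> : 0 = u by lra.
    by rewrite int_point subr0.
  - move=> s r sr rt Uy.
    have Zr : Z r = Z s.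
      apply/seteqP; split => u [/andP[u0 ur] Su]; split => //; last by lra.
      rewrite u0 /= leNgt; apply/negP => su.
      by apply: (@safe_unsafe_disjoint (y u)) => //; apply: Uy; rewrite su ur.
    have st : 0 <= s <= t by lra.
    rewrite /beta Zr; have [Z0|Z0] := asboolP.
      have [h1 h2 h3] := ZS s st Z0.
      rewrite (@int_split _ _ _ s) ?opprD ?addrA//; [by case/andP: h1|by case/andP: sr|].
      apply: (curve_Khat cv) => //; first by case/andP: h1.
      move=> u /andP[u1 u2]; have [us|su] := leP u s; first by apply: h3; rewrite u1 us.
      by apply: Uy; rewrite su u2.
    rewrite (@int_split _ _ _ s) ?opprD ?addrA//; [by case/andP: st|by case/andP: sr|].
    apply: (curve_Khat cv) => //.
    move=> u /andP[u1 u2]; have [us|su] := leP u s.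
      by apply: (nZ s) => //; rewrite ltW.
    by apply: Uy; rewrite su u2.
move=> s st; rewrite /beta; have [Z0|Z0] := asboolP.
  have [h1 h2 h3] := ZS s st Z0.
  by rewrite subr_ge0; apply: ok => //; [case/andP: st|left].
rewrite subr_ge0; apply: ok => //; [by case/andP: st => -> _; rewrite lexx|by case/andP: st| |].
  by move=> u /andP[u0 us]; apply: (nZ s) => //; rewrite ltW.
right; split => //; apply: (nZ s) => //; case/andP: st => -> _; by rewrite lexx.
Qed.

End Problem.

(** * Concatenation of runs and the value function *)

Section Runs.
Context {R : realType} {n : nat}.
Variable P : budget_reset_problem R n.
Hypothesis HP : standing_assumptions P.
Notation mu := (@lebesgue_measure R).
Notation V := ('rV[R]_n).

Lemma curve_lipschitz F2 (x : V) a y t : 0 <= F2 ->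
  (forall x a, closure (Omega P) x -> A P a -> `|f P x a| <= F2) ->
  curve P a y t ->
  (forall s (i : 'I_n), 0 <= s <= t -> y s ord0 i =
     x ord0 i + \int[mu]_(r in `[0, s]) (f P (y r) (a r) ord0 i)) ->
  forall s r, 0 <= s <= t -> 0 <= r <= t -> `|y s - y r| <= F2 * `|s - r|.
Proof.
move=> F20 FP cv yE; have [yO aA _ _] := cv.
apply: (@integral_equation_lipschitz _ _ t F2
  (fun i u => f P (y u) (a u) ord0 i) x y) => //.
  by move=> i; case: (curve_f HP i cv).
move=> i u ut; apply: le_trans (norm_coord_le _ _) _.
by apply: FP; [exact: yO|exact: aA].
Qed.

Lemma curve_path (x : V) a y t : curve P a y t ->
  (forall s (i : 'I_n), 0 <= s <= t -> y s ord0 i =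
     x ord0 i + \int[mu]_(r in `[0, s]) (f P (y r) (a r) ord0 i)) ->
  is_path P x a t y.
Proof.
move=> cv yE; split => //; last by case: cv.
have [F2 /ltW F20 FP] := speed_bound HP.
exact: lipschitz_within_continuous (curve_lipschitz F20 FP cv yE).
Qed.

Lemma path_start (x : V) a y t : 0 <= t -> is_path P x a t y -> y 0 = x.
Proof.
move=> t0 [_ _ yE]; apply/rowP => i.
by rewrite yE ?lexx// int_point addr0.
Qed.

Lemma measurable_splice_coord (t1 : R) (D D1 D2 : set R) (g1 g2 : R -> V) i :
  measurable D -> measurable D1 -> measurable D2 ->
  (forall u, D u -> u <= t1 -> D1 u) ->
  (forall u, D u -> t1 < u -> D2 (u - t1)) ->
  measurable_fun D1 (fun u => g1 u ord0 i) ->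
  measurable_fun D2 (fun u => g2 u ord0 i) ->
  measurable_fun D (fun u => splice t1 g1 g2 u ord0 i).
Proof.
move=> mD mD1 mD2 h1 h2 m1 m2.
rewrite (_ : (fun u => _) =
  splice t1 (fun u => g1 u ord0 i) (fun u => g2 u ord0 i)).
  exact: measurable_splice m1 m2.
by apply/funext => u; rewrite /splice; case: ifP.
Qed.

Lemma admissible_splice t1 a1 a2 : admissible P a1 -> admissible P a2 ->
  admissible P (splice t1 a1 a2).
Proof.
move=> [A1 m1] [A2 m2]; split.
  move=> u u0; rewrite /splice; case: leP => tu; first exact: A1.
  by apply: A2; rewrite subr_ge0 ltW.
move=> i; apply: measurable_splice_coord (m1 i) (m2 i) => // u /=.
by rewrite !in_itv /= !andbT subr_ge0 => _ /ltW.
Qed.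

Lemma splice_itv (Q1 Q2 : R -> Prop) t1 t2 :
  (forall s, 0 <= s <= t1 -> Q1 s) -> (forall s, 0 <= s <= t2 -> Q2 s) ->
  forall s, 0 <= s <= t1 + t2 -> splice t1 Q1 Q2 s.
Proof.
move=> q1 q2 s st; rewrite /splice; case: leP => h; first by apply: q1; lra.
by apply: q2; lra.
Qed.

Lemma curve_splice t1 t2 a1 a2 y1 y2 :
  curve P a1 y1 t1 -> curve P a2 y2 t2 ->
  curve P (splice t1 a1 a2) (splice t1 y1 y2) (t1 + t2).
Proof.
move=> [yO1 aA1 my1 ma1] [yO2 aA2 my2 ma2].
have h1 (u : R) : `[0, t1 + t2]%classic u -> u <= t1 -> `[0, t1]%classic u.
  by rewrite /= !in_itv /= => /andP[-> _] ->.
have h2 (u : R) : `[0, t1 + t2]%classic u -> t1 < u -> `[0, t2]%classic (u - t1).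
  by rewrite /= !in_itv /= => /andP[_ h] tu; apply/andP; split; lra.
split.
- move=> s st; have := splice_itv yO1 yO2 st.
  by rewrite /splice; case: ifP.
- move=> s st; have := splice_itv aA1 aA2 st.
  by rewrite /splice; case: ifP.
- by move=> i; exact: measurable_splice_coord (my1 i) (my2 i).
- by move=> i; exact: measurable_splice_coord (ma1 i) (ma2 i).
Qed.

Lemma path_splice x t1 t2 a1 a2 y1 y2 : 0 <= t1 -> 0 <= t2 ->
  admissible P a1 -> admissible P a2 ->
  is_path P x a1 t1 y1 -> is_path P (y1 t1) a2 t2 y2 ->
  is_path P x (splice t1 a1 a2) (t1 + t2) (splice t1 y1 y2).
Proof.
move=> t10 t20 aa1 aa2 p1 p2.
have c1 := path_curve aa1 p1; have c2 := path_curve aa2 p2.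
apply: curve_path; first exact: curve_splice.
move=> s i st.
under eq_Rintegral do rewrite (splice_map (fun p q => f P p q ord0 i)).
rewrite {1}/splice; case: leP => h.
  rewrite int_splice_left//.
  by case: p1 => _ _ yE; rewrite yE//; lra.
case: (p2) => _ _ ->; last by lra.
case: (p1) => _ _ ->; last by lra.
rewrite -addrA; congr (_ + _).
rewrite (_ : `[0, s]%classic = `[0, t1 + (s - t1)]%classic); last by rewrite addrC subrK.
rewrite int_splice//; first by lra.
- exact: curve_f.
- by apply: bounded_measurable_subitv (curve_f HP i c2) => //; lra.
Qed.

(** The competitors in the definition of [w], with the budget eliminated and the
    two exit times identified ([w_le_run], [w_ge_run]). *)
Definition run (x : V) (b : R) (a y : R -> V) (T : R) : Prop :=
  [/\ admissible P a, is_path P x a T y, budget_ok P b a y T &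
      is_minimum (exit_times P y) T].

Lemma w_le_run x b a y T : run x b a y T -> (w P x b <= total_cost P a y T)%E.
Proof.
move=> [aa py ok [[T0 bT] lT]]; apply: ereal_inf_lbound.
have cv := path_curve aa py; have cy : {within `[0, T], continuous y} by case: py.
have [_ /(_ ok)[beta bb b0]] := budget_okP HP b T0 cy cv.
exists a, y, beta, T, T; split => //; split => //; split => //.
by move=> s [+ _]; exact: lT.
Qed.

Lemma w_ge_run x b c :
  (forall a y T, run x b a y T -> (c <= total_cost P a y T)%E) -> (c <= w P x b)%E.
Proof.
move=> h; apply: le_ereal_inf_tmp => _ [a [y [beta [t [T [[aa py bb mt] mT ->]]]]]].
have tT : t = T.
  have [[[t0 bt] beta0] lt] := mt; have [[T0 bT] lT] := mT.
  apply/le_anti/andP; split; last exact: lT.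
  apply: lt; split => // s /andP[s0 sT]; apply: beta0; rewrite s0.
  by rewrite (le_trans sT)//; exact: lT.
subst t; apply: h; split => //.
have [[T0 _] _] := mT.
have cv := path_curve aa py; have cy : {within `[0, T], continuous y} by case: py.
have [h _] := budget_okP HP b T0 cy cv; apply: h.
by exists beta => //; case: mt => -[].
Qed.

(** The first piece cannot use more than [k2 * t1].  At the junction either the
    budget is reset, or what is left still covers the initial budget [b2] of the
    second piece. *)
Lemma budget_ok_splice k2 b0 b2 t1 t2 a1 a2 y1 y2 :
  0 <= k2 -> (forall x a, U P x -> A P a -> 0 <= Khat P x a <= k2) ->
  0 <= t1 -> 0 <= t2 -> curve P a1 y1 t1 -> curve P a2 y2 t2 -> y2 0 = y1 t1 ->
  k2 * t1 <= b0 -> b0 <= B P -> S P (y1 t1) \/ k2 * t1 + b2 <= b0 ->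
  budget_ok P b2 a2 y2 t2 ->
  budget_ok P b0 (splice t1 a1 a2) (splice t1 y1 y2) (t1 + t2).
Proof.
move=> k20 kP t10 t20 c1 c2 y12 kb bB Sb ok s r c /andP[s0 sr] rt Uy sc.
have cge : b0 <= c by case: sc => [[_ ->]|[_ _ ->]].
under eq_Rintegral do rewrite (splice_map (Khat P)).
have [rt1|t1r] := leP r t1.
  rewrite int_splice_left//.
  apply: (@le_trans _ _ (k2 * (r - s))).
    apply: (int_Khat_le HP kP c1) => //.
    move=> u /andP[su ur]; have := Uy u; rewrite /splice (le_trans ur rt1).
    by apply; rewrite su.
  apply: le_trans (le_trans kb cge); rewrite ler_wpM2l//; lra.
have Uy2 u : 0 < u <= r - t1 -> s - t1 < u -> U P (y2 u).
  move=> /andP[u0 ur] su; have := Uy (t1 + u); rewrite splice_right//.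
  by apply; lra.
have [t1s|st1] := leP t1 s.
  have -> : s = t1 + (s - t1) by lra.
  have -> : r = t1 + (r - t1) by lra.
  have s10 : 0 <= s - t1 by lra.
  have U2 u : s - t1 < u <= r - t1 -> U P (y2 u).
    by move=> /andP[su ur]; apply: Uy2 => //; lra.
  rewrite int_splice_right//; [|lra|apply: (curve_Khat HP c2) => //; lra].
  have [t1s'|st1] := ltP t1 s.
    apply: ok => //; [lra|lra|].
    left; case: sc => [[+ ->]|[s00]]; last by exfalso; lra.
    by rewrite /splice leNgt t1s'.
  have ts : s = t1 by apply/le_anti/andP; split.
  case: sc => [[+ cB]|[s00 + cb]].
    rewrite {1}/splice ts lexx => Sy; apply: ok; [lra|lra|by move: U2; rewrite ts|].
    by left; rewrite subrr y12.
  have t100 : t1 = 0 by lra.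
  rewrite /splice t10 => U0; case: Sb => [Sy|].
    by exfalso; apply: (safe_unsafe_disjoint HP U0); rewrite -t100.
  rewrite t100 mulr0 add0r => bb; apply: (@le_trans _ _ b2); last by rewrite cb.
  apply: ok; [lra|lra|by move=> u hu; apply: U2; lra|].
  by right; split => //; [lra|rewrite y12 t100].
(* An unsafe stretch across the junction leaves the first piece without a
   reset, and the second piece then spends at most its initial budget. *)
have Ut1 : U P (y1 t1).
  by have := Uy t1; rewrite /splice lexx; apply; rewrite st1 ltW.
case: Sb => [/(safe_unsafe_disjoint HP Ut1)//|bb].
rewrite (_ : r = t1 + (r - t1)); last by lra.
have U1 u : s < u <= t1 -> U P (y1 u).
  move=> /andP[su ut]; have := Uy u; rewrite /splice ut; apply.
  by rewrite su (le_trans ut (ltW t1r)).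
have U2 u : 0 < u <= r - t1 -> U P (y2 u).
  by move=> h; apply: Uy2 => //; lra.
rewrite int_splice//; [|lra|lra| |]; last 2 first.
- exact: (curve_Khat HP c1).
- by apply: (curve_Khat HP c2) => //; lra.
apply: le_trans cge; apply: le_trans bb; apply: lerD.
  apply: (@le_trans _ _ (k2 * (t1 - s))).
    by apply: (int_Khat_le HP kP c1) => //; lra.
  by rewrite ler_wpM2l//; lra.
apply: ok => //; [lra|lra|].
by right; split => //; rewrite y12.
Qed.

(** A transfer inside [Omega] followed by any run from its endpoint is a run,
    since the transfer does not meet the boundary before that run does. *)
Lemma w_splice K2 k2 x0 x1 b0 b2 t1 a1 y1 :
  0 <= K2 -> (forall x a, closure (Omega P) x -> A P a -> 0 <= K P x a <= K2) ->
  0 <= k2 -> (forall x a, U P x -> A P a -> 0 <= Khat P x a <= k2) ->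
  0 <= t1 -> admissible P a1 -> is_path P x0 a1 t1 y1 -> y1 t1 = x1 ->
  (forall s, 0 <= s <= t1 -> Omega P (y1 s)) ->
  k2 * t1 <= b0 -> b0 <= B P -> S P x1 \/ k2 * t1 + b2 <= b0 ->
  (w P x0 b0 <= w P x1 b2 + (K2 * t1)%:E)%E.
Proof.
move=> K20 KP k20 kP t10 aa1 p1 y1t1 yO kb bB Sb.
rewrite -leeBlDr//; apply: w_ge_run => a y T [aa py ok [[T0 bT] lT]].
rewrite leeBlDr//.
have y0 := path_start T0 py.
rewrite -y1t1 in py Sb y0.
have c1 := path_curve aa1 p1; have c2 := path_curve aa py.
apply: le_trans (w_le_run (_ : run _ _ (splice t1 a1 a) (splice t1 y1 y) (t1 + T))) _.
  split.
  - exact: admissible_splice.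
  - exact: path_splice.
  - exact: (budget_ok_splice k20 kP t10 T0 c1 c2 y0 kb bB Sb ok).
  have nbd s : 0 <= s <= t1 -> ~ boundary (Omega P) (y1 s).
    move=> /yO Oy [_]; apply; have := Omega_open HP.
    by rewrite openE; apply.
  have spT : splice t1 y1 y (t1 + T) = y T.
    move: T0; rewrite le_eqVlt => /predU1P[<-|]; last exact: splice_right.
    by rewrite addr0 /splice lexx y0.
  split; first by split; [lra|rewrite /= spT].
  move=> s [s0]; rewrite /splice; case: leP => st bs.
    by exfalso; apply: nbd bs; rewrite s0.
  have : T <= s - t1 by apply: lT; split => //; rewrite subr_ge0 ltW.
  by lra.
rewrite /total_cost.
have spT : splice t1 y1 y (t1 + T) = y T.
  move: T0; rewrite le_eqVlt => /predU1P[<-|]; last exact: splice_right.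
  by rewrite addr0 /splice lexx y0.
rewrite spT addeAC -EFinD; apply: leeD => //; rewrite lee_fin.
under eq_Rintegral do rewrite (splice_map (K P)).
rewrite int_splice//; last 2 first.
- exact: curve_K.
- exact: curve_K.
rewrite addrC lerD2l -[t1 in leRHS]subr0.
apply: int_le => //; first exact: curve_K.
move=> u ut; case: c1 => yc aA _ _.
by have /andP[] := KP _ _ (yc _ ut) (aA _ ut).
Qed.

End Runs.

(** * Picard iteration *)

Section Picard.
Context {R : realType}.
Notation mu := (@lebesgue_measure R).

Lemma le_geometric (x y C : R) :
  (forall k : nat, x <= y + C / 2 ^+ k) -> x <= y.
Proof.
move=> h; apply/ler_addgt0Pr => e e0.
have [C0|C0] := leP C 0.
  by have := h 0%N; rewrite expr0 divr1; lra.
have Ce : 0 <= C / e by rewrite divr_ge0 ?ltW.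
have k2 := archi_boundP Ce; set k := Num.bound _ in k2.
apply: le_trans (h k) _; rewrite lerD2l ler_pdivrMr ?exprn_gt0//.
rewrite mulrC -ler_pdivrMr//; apply: le_trans (ltW k2) _.
by rewrite -natrX ler_nat ltnW// ltn_expl.
Qed.

(** [u k - e k] increases, [u k + e k] decreases, where [e k = 2 * C / 2 ^+ k], and
    the former stays below the latter: the supremum of the lower bounds is the
    limit. *)
Lemma geometric_limit (u : nat -> R) C :
  (forall k, `|u k.+1 - u k| <= C / 2 ^+ k) ->
  exists l, forall k, `|u k - l| <= 2 * C / 2 ^+ k.
Proof.
move=> uC.
pose e k := 2 * C / 2 ^+ k.
have eS k : e k.+1 = C / 2 ^+ k by rewrite /e exprS; field; rewrite expf_neq0.
have e2 k : e k = C / 2 ^+ k + C / 2 ^+ k by rewrite /e; field; rewrite expf_neq0.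
have e0 k : 0 <= e k.
  by rewrite e2 addr_ge0//; exact: le_trans (uC k).
have up j k : (j <= k)%N -> u j - e j <= u k - e k /\ u k + e k <= u j + e j.
  elim: k => [|k IH]; first by rewrite leqn0 => /eqP ->.
  rewrite leq_eqVlt => /predU1P[->//|]; rewrite ltnS => /IH [h1 h2].
  rewrite (e2 k) in h1 h2; have /ler_normlP[] := uC k; rewrite eS => h3 h4.
  by split; lra.
have wv j k : u j - e j <= u k + e k.
  have [h1 _] := up j (maxn j k) (leq_maxl _ _).
  have [_ h2] := up k (maxn j k) (leq_maxr _ _).
  by have := e0 (maxn j k); lra.
pose W := range (fun j => u j - e j).
exists (sup W) => k.
have h1 : u k - e k <= sup W.
  by apply: ub_le_sup; [exists (u 0%N + e 0%N) => _ [j _ <-]; exact: wv|exists k].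
have h2 : sup W <= u k + e k.
  by apply: ge_sup; [exists (u 0%N - e 0%N); exists 0%N|move=> _ [j _ <-]; exact: wv].
by rewrite ler_norml; apply/andP; split; move: h1 h2; rewrite /e; lra.
Qed.

Section PicardIteration.
Context {n : nat}.
Notation V := ('rV[R]_n).
Variables (F : V -> V) (z : V) (rho M L h : R).
Hypotheses (h0 : 0 <= h) (M0 : 0 <= M) (L0 : 0 <= L).
Hypotheses (Mh : M * h <= rho) (Lh : L * h <= 2^-1).
Hypothesis FM : forall p, `|p - z| <= rho -> `|F p| <= M.
Hypothesis FL : forall p p', `|p - z| <= rho -> `|p' - z| <= rho ->
  `|F p - F p'| <= L * `|p - p'|.

(** Invariant of the iteration; it passes to pointwise limits and makes the
    integrands measurable. *)
Let good (y : R -> V) := (forall s, 0 <= s <= h -> `|y s - z| <= rho) /\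
  (forall s r, 0 <= s <= h -> 0 <= r <= h -> `|y s - y r| <= M * `|s - r|).

Let good_F y i : good y -> bounded_measurable `[0, h] (fun s => F (y s) ord0 i).
Proof.
move=> [yz yM]; split.
  apply: subspace_continuous_measurable_fun => //.
  move=> s; apply: (@continuous_comp _ _ _ (F \o y : subspace _ -> V) (fun v : V => v ord0 i) s); last exact: coord_continuous.
  move: s; apply: (@lipschitz_within_continuous _ _ h (L * M) (F \o y)).
  move=> s r sh rh /=; rewrite -mulrA; apply: le_trans (FL _ _) _; [exact: yz|exact: yz|].
  by rewrite ler_wpM2l// yM.
exists M => s /=; rewrite in_itv /= => sh.
by apply: le_trans (norm_coord_le _ _) _; apply: FM; exact: yz.
Qed.

Let next (y : R -> V) (s : R) : V :=
  \row_i (z ord0 i + \int[mu]_(r in `[0, s]) (F (y r) ord0 i)).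

Let good_next y : good y -> good (next y).
Proof.
move=> gy; have [yz yM] := gy.
have nM s r : 0 <= s <= h -> 0 <= r <= h -> `|next y s - next y r| <= M * `|s - r|.
  apply: (@integral_equation_lipschitz _ _ h M (fun i u => F (y u) ord0 i) z) => //.
  - by move=> i; case: (good_F i gy).
  - by move=> i u uh; apply: le_trans (norm_coord_le _ _) _; apply: FM; exact: yz.
  - by move=> s' i _; rewrite mxE.
split=> // s sh.
have -> : z = next y 0 by apply/rowP => i; rewrite mxE int_point addr0.
apply: le_trans (nM _ _ _ _) _ => //; first by rewrite lexx.
case/andP: sh => s0 sh.
by rewrite subr0 ger0_norm//; apply: le_trans Mh; rewrite ler_wpM2l.
Qed.

Let next_dist y y' d : good y -> good y' ->
  (forall s, 0 <= s <= h -> `|y s - y' s| <= d) ->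
  forall s, 0 <= s <= h -> `|next y s - next y' s| <= d / 2.
Proof.
move=> gy gy' yd s /andP[s0 sh].
have d0 : 0 <= d by apply: le_trans (yd 0 _) => //; rewrite lexx.
apply: norm_leP => [|i]; first by rewrite divr_ge0.
have sub u : `[0, s]%classic u -> 0 <= u <= h.
  by rewrite /= in_itv /= => /andP[-> us]; exact: le_trans us sh.
have b : bounded_measurable `[0, s] (fun r => F (y r) ord0 i).
  exact: bounded_measurable_subitv (good_F i gy).
have b' : bounded_measurable `[0, s] (fun r => F (y' r) ord0 i).
  exact: bounded_measurable_subitv (good_F i gy').
rewrite !mxE opprD addrACA subrr add0r -RintegralB//; last 2 first.
- exact: bounded_measurable_integrable.
- exact: bounded_measurable_integrable.
apply: (@le_trans _ _ (L * d * (s - 0))).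
  apply: norm_int_le => //.
    split; first by apply: measurable_funB; [case: b|case: b'].
    case: b b' => _ [B1 h1] [_ [B2 h2]]; exists (B1 + B2) => u us.
    by apply: le_trans (ler_normB _ _) _; apply: lerD; [exact: h1|exact: h2].
  move=> u us; have uh : 0 <= u <= h by apply: sub; rewrite /= in_itv.
  have := norm_coord_le (F (y u) - F (y' u)) i; rewrite !mxE => /le_trans; apply.
  apply: le_trans (FL _ _) _; [exact: (proj1 gy)|exact: (proj1 gy')|].
  by rewrite ler_wpM2l// yd.
rewrite subr0 mulrAC mulrC; apply: ler_wpM2l => //.
by apply: le_trans Lh; rewrite ler_wpM2l.
Qed.

Let iterate k := iter k next (fun=> z).

(** As [L * h <= 1 / 2], each iteration halves the distance of two candidates
    ([next_dist]); the iterates converge geometrically and the limit is a fixed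
    point. *)
Lemma picard_solution : exists y : R -> V,
  (forall s, 0 <= s <= h -> `|y s - z| <= rho) /\
  (forall s r, 0 <= s <= h -> 0 <= r <= h -> `|y s - y r| <= M * `|s - r|) /\
  (forall s i, 0 <= s <= h ->
    y s ord0 i = z ord0 i + \int[mu]_(r in `[0, s]) (F (y r) ord0 i)).
Proof.
have rho0 : 0 <= rho by apply: le_trans Mh; rewrite mulr_ge0.
have gi k : good (iterate k).
  elim: k => [|k IH]; last exact: good_next.
  by split => [s|s r] _; rewrite subrr normr0// => _; rewrite mulr_ge0.
have di k s : 0 <= s <= h -> `|iterate k.+1 s - iterate k s| <= rho / 2 ^+ k.
  elim: k s => [|k IH] s sh.
    by rewrite expr0 divr1; exact: (proj1 (gi 1%N)).
  rewrite exprS invfM [2^-1 * _]mulrC mulrA.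
  exact: (@next_dist (iterate k.+1) (iterate k)).
have lim s : exists ys, 0 <= s <= h ->
    forall k, `|iterate k s - ys| <= 2 * rho / 2 ^+ k.
  have [sh|nsh] := boolP (0 <= s <= h); last by exists 0.
  have li i : exists l, forall k, `|iterate k s ord0 i - l| <= 2 * rho / 2 ^+ k.
    apply: geometric_limit => k; apply: le_trans (di k s sh).
    by have := norm_coord_le (iterate k.+1 s - iterate k s) i; rewrite !mxE.
  have [l lP] := choice li; exists (\row_i l i) => _ k.
  apply: norm_leP => [|i]; last by rewrite !mxE.
  by rewrite divr_ge0 ?mulr_ge0// exprn_ge0.
have [y yP] := choice lim.
have gy : good y.
  split=> [s sh|s r sh rh].
    apply: (@le_geometric _ _ (2 * rho)) => k.
    have := ler_distD (iterate k s) (y s) z; have := yP s sh k.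
    have := (gi k).1 s sh; rewrite [`|y s - iterate _ _|]distrC; lra.
  apply: (@le_geometric _ _ (4 * rho)) => k.
  have e : 4 * rho / 2 ^+ k = 2 * rho / 2 ^+ k + 2 * rho / 2 ^+ k.
    by field; rewrite expf_neq0.
  have := ler_distD (iterate k s) (y s) (y r).
  have := ler_distD (iterate k r) (iterate k s) (y r).
  have := yP s sh k; have := yP r rh k.
  have := (gi k).2 s r sh rh; rewrite e [`|y s - iterate _ _|]distrC; lra.
exists y; split; [exact: gy.1|split; [exact: gy.2|]].
move=> s i sh.
suff : `|y s - next y s| <= 0.
  by rewrite normr_le0 subr_eq0 => /eqP {1}->; rewrite mxE.
apply: (@le_geometric _ _ (2 * rho)) => k; rewrite add0r.
have := ler_distD (iterate k.+1 s) (y s) (next y s).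
have := yP s sh k.+1.
have := @next_dist (iterate k) y _ (gi k) gy (fun s sh => yP s sh k) s sh.
have e : 2 * rho / 2 ^+ k.+1 = rho / 2 ^+ k by rewrite exprS; field; rewrite expf_neq0.
have e' : 2 * rho / 2 ^+ k / 2 = rho / 2 ^+ k by field; rewrite expf_neq0.
have e2 : 2 * rho / 2 ^+ k = rho / 2 ^+ k + rho / 2 ^+ k by field; rewrite expf_neq0.
rewrite e e' e2 [`|y s - iterate _ _|]distrC; lra.
Qed.

End PicardIteration.
End Picard.

(** * One step towards a target *)

Section HalvingStep.
Context {R : realType} {n : nat}.
Variable P : budget_reset_problem R n.
Hypothesis HP : standing_assumptions P.
Notation mu := (@lebesgue_measure R).
Notation V := ('rV[R]_n).

Lemma enormZ (k : R) (v : V) : 0 <= k -> enorm (k *: v) = k * enorm v.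
Proof.
move=> k0; rewrite /enorm (_ : dotv (k *: v) (k *: v) = k ^+ 2 * dotv v v).
  by rewrite sqrtrM ?sqr_ge0// sqrtr_sqr ger0_norm.
by rewrite /dotv mulr_sumr; apply: eq_bigr => i _; rewrite !mxE; ring.
Qed.

Lemma dotv_sub_scale (u v : V) (k : R) :
  dotv (u - k *: v) (u - k *: v) =
  dotv u u - 2 * k * dotv v u + k ^+ 2 * dotv v v.
Proof.
rewrite /dotv !mulr_sumr -sumrB -big_split /=.
by apply: eq_bigr => i _; rewrite !mxE; ring.
Qed.

(** The case of equality in the Cauchy-Schwarz inequality, from
    [`|u - (enorm u) v|^2 = 0] in the Euclidean norm. *)
Lemma colinear_of_dotv (u v : V) : enorm v = 1 -> dotv v u = enorm u ->
  u = enorm u *: v.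
Proof.
move=> v1 vu; apply/eqP; rewrite -subr_eq0 -normr_le0.
apply: le_trans (norm_le_enorm _) _.
rewrite /enorm dotv_sub_scale -/(enorm u) vu -!enorm_sqr v1.
by rewrite (_ : _ + _ = 0) ?sqrtr0//; ring.
Qed.

Lemma f_lipschitz : exists2 L, 0 < L & forall p p' a,
  closure (Omega P) p -> closure (Omega P) p' -> A P a ->
  `|f P p a - f P p' a| <= L * `|p - p'|.
Proof.
have [/lipschitz_pairP[L L0 LP] _] := Lipschitz_data HP.
exists L => // p p' a Op Op' Aa.
apply: le_trans (LP (p, a) (p', a) _ _) _; [by []|by []|].
rewrite prod_normE /= subrr normr0.
by rewrite (_ : Num.max _ _ = `|p - p'|)//; apply/max_idPl.
Qed.

Lemma velocity_towards (F1 : R) (z x1 : V) : z != x1 ->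
  0 < F1 ->
  (forall x v, closure (Omega P) x -> enorm v = 1 ->
    exists a, [/\ A P a, dotv v (f P x a) = enorm (f P x a) &
                        F1 <= enorm (f P x a)]) ->
  closure (Omega P) z ->
  exists a tau, [/\ A P a, 0 <= tau, tau <= n%:R / F1 * `|x1 - z| &
    tau *: f P z a = x1 - z].
Proof.
move=> zx1 F10 ctrl Oz; set d := x1 - z.
have d0 : 0 < `|d| by rewrite normr_gt0 subr_eq0 eq_sym.
have e0 : 0 < enorm d by exact: lt_le_trans (norm_le_enorm _).
have [|a [Aa va Fa]] := ctrl z ((enorm d)^-1 *: d) Oz.
  by rewrite enormZ ?invr_ge0 ?ltW// mulVf// gt_eqF.
have f0 : 0 < enorm (f P z a) by exact: lt_le_trans Fa.
exists a, (enorm d / enorm (f P z a)); split => //.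
- by rewrite divr_ge0 ?ltW.
- rewrite [leRHS]mulrAC; apply: ler_pM; [exact: ltW|by rewrite invr_ge0 ltW| |].
    exact: enorm_le.
  by rewrite lef_pV2// posrE.
have v1 : enorm ((enorm d)^-1 *: d) = 1.
  by rewrite enormZ ?invr_ge0 ?ltW// mulVf// gt_eqF.
rewrite [X in _ *: X](colinear_of_dotv v1 va) !scalerA.
rewrite divfK ?gt_eqF// mulfV ?gt_eqF//; exact: scale1r.
Qed.

Definition halving_step (c r : R) (x1 z a : V) (tau : R) (y : R -> V) : Prop :=
  [/\ A P a, 0 <= tau <= c * `|x1 - z|, is_path P z (fun=> a) tau y,
      `|x1 - y tau| <= `|x1 - z| / 2 &
      forall s, 0 <= s <= tau -> `|y s - x1| <= r].

(** If the velocity kept its initial value [f z a], the control [a] chosen at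
    [z] by [velocity_towards] would lead to [x1] at time [tau].  As [f] is
    Lipschitz in the position, the velocity changes by at most [L * F2 * tau]
    meanwhile, so that the miss is at most [L * F2 * tau ^ 2]: quadratic in the
    distance [`|x1 - z|], hence at most half of it when the latter is small. *)
Lemma exists_halving_step : exists F2 c delta0 : R, [/\ 0 < F2, 0 <= c,
  (forall x a, closure (Omega P) x -> A P a -> `|f P x a| <= F2) &
  0 < delta0 /\ forall a0 x1 r delta z, A P a0 -> 0 < r ->
    (forall p, `|p - x1| <= r -> Omega P p) ->
    delta <= delta0 -> delta <= r / 2 -> F2 * c * delta <= r / 2 ->
    `|x1 - z| <= delta ->
    exists a tau y, halving_step c r x1 z a tau y].
Proof.
have [F2 F20 FP] := speed_bound HP.
have [L L0 LP] := f_lipschitz.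
have [F1 [_ [F10 _ ctrl]]] := Controllability HP.
pose c := n%:R / F1.
have c0 : 0 <= c by rewrite divr_ge0// ltW.
(* The first summand makes the Picard iteration contract during the step, the
   second one makes the quadratic miss at most half of the distance. *)
pose delta0 := (2 * (L * c + L * F2 * c ^+ 2 + 1))^-1.
have LF0 : 0 <= L * F2 * c ^+ 2 by rewrite mulr_ge0 ?sqr_ge0// mulr_ge0// ltW.
have Lc0 : 0 <= L * c by rewrite mulr_ge0// ltW.
have del0 : 0 < delta0 by rewrite invr_gt0; lra.
exists F2, c, delta0; split=> //; split; first exact: del0.
move=> a0 x1 r delta z Aa0 r0 rO dd0 dr Fdr zd.
have d_ge0 := le_trans (normr_ge0 _) zd.
have d1 : L * c * delta <= 2^-1 /\ L * F2 * c ^+ 2 * delta <= 2^-1.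
  have del1 : (2 * (L * c + L * F2 * c ^+ 2 + 1)) * delta <= 1.
    by rewrite mulrC -ler_pdivlMr ?div1r//; lra.
  have h1 : 0 <= L * c * delta by rewrite mulr_ge0.
  have h2 : 0 <= L * F2 * c ^+ 2 * delta by rewrite mulr_ge0.
  by split; lra.
have Oz : closure (Omega P) z.
  by apply: subset_closure; apply: rO; rewrite distrC; lra.
have [a [tau [Aa tau0 tauc tauf]]] : exists a tau, [/\ A P a, 0 <= tau,
    tau <= c * `|x1 - z| & tau *: f P z a = x1 - z].
  have [->|zx1] := eqVneq z x1; last exact: velocity_towards.
  by exists a0, 0; rewrite subrr scale0r normr0 mulr0.
have tauD : tau <= c * delta by apply: le_trans tauc _; rewrite ler_wpM2l.
have ball_O p : `|p - z| <= r / 2 -> Omega P p.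
  move=> pz; apply: rO; apply: le_trans (ler_distD z _ _) _.
  by move: zd; rewrite (distrC x1); lra.
have Ltau : L * tau <= 2^-1.
  by apply: le_trans d1.1; rewrite -mulrA ler_wpM2l// ltW.
have Ftau : F2 * tau <= r / 2.
  by apply: le_trans Fdr; rewrite -mulrA ler_wpM2l// ltW.
have [y [yr [yL yE]]] := @picard_solution R n (fun p => f P p a) z (r / 2) F2 L tau
  tau0 (ltW F20) (ltW L0) Ftau Ltau
  (fun p pz => FP p a (subset_closure (ball_O p pz)) Aa)
  (fun p p' pz pz' => LP p p' a (subset_closure (ball_O p pz))
     (subset_closure (ball_O p' pz')) Aa).
have py : is_path P z (fun=> a) tau y.
  split => //; first exact: lipschitz_within_continuous yL.
  by move=> s st; apply: subset_closure; apply: ball_O; exact: yr.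
have aa : admissible P (fun=> a) by split.
have cv := path_curve aa py.
have y0 : y 0 = z by exact: path_start py.
exists a, tau, y; split => //.
- by rewrite tau0.
- apply: (@le_trans _ _ (L * F2 * c ^+ 2 * delta * `|x1 - z|)); last first.
    by rewrite mulrC; apply: ler_wpM2l => //; exact: d1.2.
  apply: (@le_trans _ _ (L * (F2 * tau) * (tau - 0))).
    apply: norm_leP => [|i]; first by rewrite subr0 !mulr_ge0// ltW.
    have -> : (x1 - y tau) ord0 i =
        - \int[mu]_(s in `[0, tau]) (f P (y s) a ord0 i - f P z a ord0 i).
      rewrite RintegralB//; last 2 first.
      - exact: bounded_measurable_integrable (curve_f HP i cv).
      - apply: bounded_measurable_integrable; split => //.
        by exists `|f P z a ord0 i|.
      have -> : \int[mu]_(s in `[0, tau]) f P z a ord0 i = x1 ord0 i - z ord0 i.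
        have /rowP/(_ i) := tauf; rewrite !mxE => <-.
        rewrite Rintegral_cst//= lebesgue_measure_itv /= lte_fin.
        case: ltgtP tau0 => //= [_ _|<- _]; first by rewrite subr0 mulrC.
        by rewrite mulr0 mul0r.
      have := yE tau i; rewrite tau0 lexx => /(_ isT) yt.
      by rewrite !mxE yt; ring.
    rewrite normrN; apply: norm_int_le => //.
      have [mf [M fM]] := curve_f HP i cv; split; first exact: measurable_funB.
      exists (M + `|f P z a ord0 i|) => s st.
      by apply: le_trans (ler_normB _ _) _; rewrite lerD2r; exact: fM.
    move=> s st; have := norm_coord_le (f P (y s) a - f P z a) i.
    rewrite !mxE => /le_trans; apply; apply: le_trans (LP _ _ _ _ _ Aa) _ => //.
      by apply: subset_closure; apply: ball_O; exact: yr.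
    rewrite ler_wpM2l ?(ltW L0)//.
    have := yL s 0 st; rewrite lexx tau0 y0 => /(_ isT) /le_trans; apply.
    rewrite ler_wpM2l ?(ltW F20)// subr0.
    by case/andP: st => s0 st; rewrite ger0_norm.
  rewrite subr0 (_ : _ * tau = L * F2 * (tau * tau)); last by ring.
  rewrite (_ : _ * `|x1 - z| = L * F2 * ((c * delta) * (c * `|x1 - z|))); last by ring.
  apply: ler_wpM2l; first by rewrite mulr_ge0// ltW.
  exact: ler_pM.
- move=> s st; apply: le_trans (ler_distD z _ _) _.
  have := yr s st; move: zd; rewrite (distrC x1); lra.
Qed.

End HalvingStep.

(** * Reaching a target exactly *)

(** The limit of functions [G k] that stabilise on the half lines up to [T k],
    with value [d] beyond all the [T k]. *)
Definition glue {R : realType} {X : Type} (T : nat -> R) (G : nat -> R -> X)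
    (d : X) (s : R) : X :=
  match pselect (exists k, s <= T k) with
  | left e => G (projT1 (cid e)) s
  | right _ => d
  end.

Section Glue.
Context {R : realType}.
Notation mu := (@lebesgue_measure R).
Variable T : nat -> R.

Lemma glueE X (G : nat -> R -> X) d k s :
  (forall j m, (j <= m)%N -> s <= T j -> G m s = G j s) ->
  s <= T k -> glue T G d s = G k s.
Proof.
move=> GG sk; rewrite /glue; case: pselect => [e|]; last by case; exists k.
case: cid => j /= sj.
by have [jk|kj] := leqP j k; [rewrite -(GG _ _ jk)|rewrite (GG _ _ (ltnW kj))].
Qed.

Lemma glue_end X (G : nat -> R -> X) d s : (forall k, T k < s) -> glue T G d s = d.
Proof.
move=> h; rewrite /glue; case: pselect => // e; exfalso.
by case: e => k; rewrite leNgt h.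
Qed.

Lemma glueP s :
  (exists k, s <= T k) \/ (forall k, T k < s).
Proof.
have [e|ne] := pselect (exists k, s <= T k); first by left.
by right=> k; rewrite ltNge; apply/negP => h; apply: ne; exists k.
Qed.

Lemma measurable_glue (G : nat -> R -> R) d (D : set R) : measurable D ->
  (forall s j m, D s -> (j <= m)%N -> s <= T j -> G m s = G j s) ->
  (forall k, measurable_fun (D `&` [set s | s <= T k]) (G k)) ->
  measurable_fun D (glue T G d).
Proof.
move=> mD GG mG.
have mI k : measurable [set s | s <= T k].
  rewrite (_ : [set _ | _] = `]-oo, T k]%classic); first exact: measurable_itv.
  by apply/seteqP; split => s /=; rewrite in_itv.
have mU : measurable (\bigcup_k (D `&` [set s | s <= T k])).
  by apply: bigcupT_measurable => k; exact: measurableI.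
have -> : D = (\bigcup_k (D `&` [set s | s <= T k])) `|`
    (D `\` \bigcup_k (D `&` [set s | s <= T k])).
  by rewrite setDUK// => s [k _ []].
apply/measurable_funU => //; first exact: measurableD.
split.
  apply/measurable_fun_bigcup => [k|k]; first exact: measurableI.
  apply: eq_measurable_fun (mG k) => s; rewrite inE => -[Ds sk].
  by rewrite (@glueE _ _ _ k)// => j m; exact: GG.
apply: (@eq_measurable_fun _ _ _ _ _ (cst d)) => // s; rewrite inE => -[Ds ns].
rewrite glue_end// => k; rewrite ltNge; apply/negP => sk.
by apply: ns; exists k.
Qed.

End Glue.

Section Steer.
Context {R : realType} {n : nat}.
Variable P : budget_reset_problem R n.
Hypothesis HP : standing_assumptions P.
Notation mu := (@lebesgue_measure R).
Notation V := ('rV[R]_n).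

(** Halving steps are repeated from [x0]: the [k]-th one starts at [z k], at
    time [T k], with [`|x1 - z k| <= D / 2 ^+ k].  Its duration is at most
    [c * D / 2 ^+ k], so the times [T k] have a finite supremum, and the curve
    glued from all the steps is at [x1] at that time. *)
Section Concatenation.
Variables (F2 c r D : R) (x0 x1 a0 : V).
Variables (ctrl : V -> V) (dur : V -> R) (piece : V -> R -> V).
Hypotheses (F20 : 0 < F2) (c0 : 0 <= c).
Hypothesis FP : forall x a, closure (Omega P) x -> A P a -> `|f P x a| <= F2.
Hypothesis Aa0 : A P a0.
Hypothesis rO : forall p, `|p - x1| <= r -> Omega P p.
Hypotheses (Dr : D <= r) (Dx : `|x1 - x0| = D).
Hypothesis stepP : forall z, `|x1 - z| <= D ->
  halving_step P c r x1 z (ctrl z) (dur z) (piece z).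

Let z k := iter k (fun z => piece z (dur z)) x0.
Let T k := \sum_(j < k) dur (z j).
Fixpoint concat_control k : R -> V :=
  if k is k'.+1 then splice (T k') (concat_control k') (fun=> ctrl (z k')) else fun=> a0.
Fixpoint concat_path k : R -> V :=
  if k is k'.+1 then splice (T k') (concat_path k') (piece (z k')) else fun=> x0.

Let D0 : 0 <= D. Proof. by rewrite -Dx. Qed.

Let Dk k : D / 2 ^+ k <= D.
Proof.
rewrite ler_pdivrMr ?exprn_gt0// ler_peMr//.
by rewrite exprn_ege1// ler1n.
Qed.

Let z_dist k : `|x1 - z k| <= D / 2 ^+ k.
Proof.
elim: k => [|k IH]; first by rewrite expr0 divr1 -Dx.
have [_ _ _ h _] := stepP (le_trans IH (Dk k)).
apply: le_trans h _; rewrite exprS invfM [2^-1 * _]mulrC mulrA.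
by rewrite ler_wpM2r.
Qed.

Let z_near k : `|x1 - z k| <= D := le_trans (z_dist k) (Dk k).

Let TS k : T k.+1 = T k + dur (z k).
Proof. by rewrite /T big_ord_recr. Qed.

Let dur_ge0 k : 0 <= dur (z k).
Proof. by have [_ /andP[] ] := stepP (z_near k). Qed.

Let dur_le k : dur (z k) <= c * D / 2 ^+ k.
Proof.
have [_ /andP[_ h] _ _ _] := stepP (z_near k); apply: le_trans h _.
by rewrite -mulrA ler_wpM2l.
Qed.

Let T_mono j k : (j <= k)%N -> T j <= T k.
Proof.
elim: k => [|k IH]; first by rewrite leqn0 => /eqP ->.
rewrite leq_eqVlt => /predU1P[->//|]; rewrite ltnS => /IH h.
by rewrite TS; apply: le_trans h _; rewrite lerDl.
Qed.

Let T_ge0 k : 0 <= T k.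
Proof. by have := T_mono (leq0n k); rewrite {1}/T big_ord0. Qed.

Let T_tail j k : T k <= T j + 2 * (c * D) / 2 ^+ j.
Proof.
have tail0 i : 0 <= 2 * (c * D) / 2 ^+ i.
  by rewrite divr_ge0 ?exprn_ge0// mulr_ge0// mulr_ge0.
have [kj|jk] := leqP k j.
  by apply: le_trans (T_mono kj) _; rewrite lerDl.
suff : T k + 2 * (c * D) / 2 ^+ k <= T j + 2 * (c * D) / 2 ^+ j.
  by apply: le_trans; rewrite lerDl.
elim: k jk => // k IH; rewrite ltnS leq_eqVlt => /predU1P[->|/IH]; last first.
  apply: le_trans; rewrite TS.
  have := dur_le k; rewrite exprS.
  rewrite (_ : 2 * (c * D) / (2 * 2 ^+ k) = c * D / 2 ^+ k); last by field; rewrite expf_neq0.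
  rewrite (_ : 2 * (c * D) / 2 ^+ k = c * D / 2 ^+ k + c * D / 2 ^+ k); last by field; rewrite expf_neq0.
  lra.
rewrite TS; have := dur_le k; rewrite exprS.
rewrite (_ : 2 * (c * D) / (2 * 2 ^+ k) = c * D / 2 ^+ k); last by field; rewrite expf_neq0.
rewrite (_ : 2 * (c * D) / 2 ^+ k = c * D / 2 ^+ k + c * D / 2 ^+ k); last by field; rewrite expf_neq0.
lra.
Qed.

Let Tinf := sup (range T).

Let T_hsup : has_sup (range T).
Proof.
split; first by exists (T 0); exists 0%N.
by exists (T 0 + 2 * (c * D) / 2 ^+ 0) => _ [k _ <-]; exact: T_tail.
Qed.

Let T_le k : T k <= Tinf.
Proof. by apply: ub_le_sup; [case: T_hsup|exists k]. Qed.

Let Tinf_tail j : Tinf <= T j + 2 * (c * D) / 2 ^+ j.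
Proof. by apply: ge_sup; [case: T_hsup|move=> _ [k _ <-]; exact: T_tail]. Qed.

Let Tinf_ge0 : 0 <= Tinf := le_trans (T_ge0 0) (T_le 0).

Let concat_control_eq j m s : (j <= m)%N -> s <= T j -> concat_control m s = concat_control j s.
Proof.
elim: m => [|m IH]; first by rewrite leqn0 => /eqP ->.
rewrite leq_eqVlt => /predU1P[->//|]; rewrite ltnS => jm sj /=.
by rewrite /splice (le_trans sj (T_mono jm)) IH.
Qed.

Let concat_path_eq j m s : (j <= m)%N -> s <= T j -> concat_path m s = concat_path j s.
Proof.
elim: m => [|m IH]; first by rewrite leqn0 => /eqP ->.
rewrite leq_eqVlt => /predU1P[->//|]; rewrite ltnS => jm sj /=.
by rewrite /splice (le_trans sj (T_mono jm)) IH.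
Qed.

Let concat_control_admissible k : admissible P (concat_control k).
Proof.
elim: k => [|k IH]; first by split.
apply: admissible_splice => //; split => // t _.
by have [] := stepP (z_near k).
Qed.

Let concat_path_path k : is_path P x0 (concat_control k) (T k) (concat_path k) /\ concat_path k (T k) = z k.
Proof.
elim: k => [|k [IH IHz]].
  have O0 : Omega P x0 by apply: rO; rewrite distrC Dx.
  split => //; rewrite /T big_ord0; apply: curve_path => //.
    by split => // s _; exact: subset_closure.
  move=> s i /andP[s0 s0']; have -> : s = 0 by apply/le_anti/andP; split.
  by rewrite int_point addr0.
have [Ac _ pz _ _] := stepP (z_near k).
split.
  have ac : admissible P (fun=> ctrl (z k)) by split.
  have pz' : is_path P (concat_path k (T k)) (fun=> ctrl (z k)) (dur (z k)) (piece (z k)).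
    by rewrite IHz.
  rewrite TS.
  exact: (path_splice HP (T_ge0 k) (dur_ge0 k) (concat_control_admissible k) ac IH pz').
have z0 : piece (z k) 0 = z k by exact: path_start pz.
rewrite TS /= /splice; case: leP => h.
  have d0 : dur (z k) = 0 by have := dur_ge0 k; lra.
  by rewrite d0 addr0 IHz z0.
by rewrite addrAC subrr add0r.
Qed.

Let concat_path_near k s : 0 <= s <= T k -> `|concat_path k s - x1| <= r.
Proof.
elim: k s => [|k IH] s.
  by move=> _ /=; rewrite distrC Dx.
rewrite TS => /andP[s0 sk] /=; rewrite /splice; case: (leP s (T k)) => h.
  by apply: IH; rewrite s0 h.
have [_ _ _ _] := stepP (z_near k); apply.
by apply/andP; split; lra.
Qed.

Let limit_control := glue T concat_control a0.
Let limit_path := glue T concat_path x1.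

Let limit_controlE k s : s <= T k -> limit_control s = concat_control k s.
Proof. by apply: glueE => j m; exact: concat_control_eq. Qed.

Let limit_pathE k s : s <= T k -> limit_path s = concat_path k s.
Proof. by apply: glueE => j m; exact: concat_path_eq. Qed.

Let limit_control_admissible : admissible P limit_control.
Proof.
split=> [t t0|i].
  rewrite /limit_control /glue; case: pselect => // e.
  by case: (concat_control_admissible (projT1 (cid e))) => + _; apply.
rewrite (_ : (fun t => _) = glue T (fun k s => concat_control k s ord0 i) (a0 ord0 i)).
  apply: measurable_glue => // [s j m _ jm sj|k]; first by rewrite (concat_control_eq jm).
  by case: (concat_control_admissible k) => _ m; apply: measurable_funS (m i).
by apply/funext => s; rewrite /limit_control /glue; case: pselect.
Qed.

Let limit_path_near s : 0 <= s -> `|limit_path s - x1| <= r.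
Proof.
move=> s0; have [[k sk]|h] := glueP T s.
  by rewrite (limit_pathE sk); apply: concat_path_near; rewrite s0.
by rewrite /limit_path glue_end// subrr normr0 (le_trans D0).
Qed.

(** If the supremum is attained at some [T k], all later steps have duration
    zero and their starting points, which tend to [x1], coincide. *)
Let limit_path_end : limit_path Tinf = x1.
Proof.
have [[k sk]|h] := glueP T Tinf; last exact: glue_end.
apply/eqP; rewrite eq_sym -subr_eq0 -normr_le0.
apply: (@le_geometric _ _ _ D) => m; rewrite add0r.
pose j := maxn k m.
have Tj : Tinf = T j.
  by apply/le_anti; rewrite T_le andbT (le_trans sk)// T_mono// leq_maxl.
have Yj : limit_path Tinf = z j by rewrite Tj (limit_pathE (lexx _)); exact: (concat_path_path j).2.
rewrite Yj; apply: le_trans (z_dist j) _.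
rewrite ler_wpM2l// lef_pV2 ?posrE ?exprn_gt0//.
by rewrite ler_weXn2l ?ler1n// leq_maxr.
Qed.

Let limit_curve : curve P limit_control limit_path Tinf.
Proof.
split.
- by move=> s /andP[s0 _]; apply: subset_closure; apply: rO; exact: limit_path_near.
- by move=> s /andP[s0 _]; case: limit_control_admissible => + _; apply.
- move=> i.
  rewrite (_ : (fun t => _) = glue T (fun k s => concat_path k s ord0 i) (x1 ord0 i)).
    apply: measurable_glue => // [s j m _ jm sj|k]; first by rewrite (concat_path_eq jm).
    apply: measurable_funS (path_measurable (concat_path_path k).1 i) => // s /=.
    by rewrite !in_itv /= => -[/andP[-> _] ->].
  by apply/funext => s; rewrite /limit_path /glue; case: pselect.
- by move=> i; exact: (admissible_measurable limit_control_admissible (lexx _)).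
Qed.

Let limit_path_path : is_path P x0 limit_control Tinf limit_path.
Proof.
apply: curve_path => // s i /andP[s0 sT].
have part k u : 0 <= u <= T k ->
    limit_path u ord0 i = x0 ord0 i + \int[mu]_(q in `[0, u]) f P (limit_path q) (limit_control q) ord0 i.
  case/andP=> u0 uk; rewrite (limit_pathE uk).
  have [[_ _ yE] _] := concat_path_path k; rewrite yE ?u0//.
  congr (_ + _); apply: eq_int => q /andP[_ qu].
  by rewrite (limit_pathE (le_trans qu uk)) (limit_controlE (le_trans qu uk)).
have [[k sk]|h] := glueP T s; first by apply: (part k); rewrite s0.
have -> : s = Tinf.
  by apply/le_anti; rewrite sT /=; apply: ge_sup;
    [case: T_hsup|move=> _ [k _ <-]; exact: ltW].
(* At the final time the equation at [T k] leaves an error of order [2 ^- k]: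
   the distance from [z k] to [x1] and the integral over the remaining time. *)
apply/eqP; rewrite -subr_eq0 -normr_le0.
apply: (@le_geometric _ _ _ (D + F2 * (2 * (c * D)))) => k; rewrite add0r.
have bm := curve_f HP i limit_curve.
rewrite limit_path_end (@int_split _ _ _ (T k))//.
have := part k (T k); rewrite T_ge0 lexx => /(_ isT).
rewrite (limit_pathE (lexx _)) (concat_path_path k).2 addrA => <-.
rewrite opprD addrA; apply: le_trans (ler_normB _ _) _.
rewrite mulrDl; apply: lerD.
  apply: le_trans (z_dist k).
  by have := norm_coord_le (x1 - z k) i; rewrite !mxE.
apply: (@le_trans _ _ (F2 * (Tinf - T k))).
  apply: norm_int_le => //; first exact: bounded_measurable_subitv bm.
  move=> u /andP[uk uT]; apply: le_trans (norm_coord_le _ _) _.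
  have u0 : 0 <= u by exact: le_trans uk.
  apply: FP; first by apply: subset_closure; apply: rO; exact: limit_path_near.
  by case: limit_control_admissible => + _; apply.
rewrite -mulrA ler_wpM2l ?(ltW F20)//.
by have := Tinf_tail k; lra.
Qed.

Lemma steer_concatenation : exists a y t, [/\ 0 <= t <= 2 * (c * D),
  admissible P a, is_path P x0 a t y, y t = x1 &
  forall s, 0 <= s <= t -> `|y s - x1| <= r].
Proof.
exists limit_control, limit_path, Tinf; split => //; last by move=> s /andP[s0 _]; exact: limit_path_near.
rewrite Tinf_ge0; have := Tinf_tail 0.
by rewrite expr0 divr1 /T big_ord0 add0r.
Qed.

End Concatenation.

(** Local controllability, with a time linear in the distance.  The target is hit
    exactly: the safe set may reduce to a point near [x], and the budget is only
    reset there. *)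
Lemma steer x : Omega P x -> exists2 e : R, 0 < e & exists2 C : R, 0 <= C &
  forall x0 x1, `|x0 - x| < e -> `|x1 - x| < e -> x0 != x1 ->
  exists a y t, [/\ 0 <= t <= C * `|x1 - x0|,
    admissible P a, is_path P x0 a t y, y t = x1 &
    forall s, 0 <= s <= t -> Omega P (y s)].
Proof.
move=> Ox.
have [F2 [c [delta0 [F20 c0 FP [del0 step]]]]] := exists_halving_step HP.
have /nbhs_ballP[/= r2 r20 ball_O] : nbhs x (Omega P).
  exact: open_nbhs_nbhs (conj (Omega_open HP) Ox).
pose r := r2 / 2.
have r0 : 0 < r by rewrite divr_gt0.
have Fc0 : 0 <= F2 * c by rewrite mulr_ge0// ltW.
pose delta := Num.min delta0 (Num.min (r / 2) (r / 2 / (F2 * c + 1))).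
have d0 : 0 < delta.
  by rewrite !lt_min del0 !divr_gt0//= ltr_wpDl.
have dd0 : delta <= delta0 by rewrite ge_min lexx.
have dr : delta <= r / 2 by rewrite !ge_min lexx orbT.
have Fd : F2 * c * delta <= r / 2.
  have : delta <= r / 2 / (F2 * c + 1) by rewrite !ge_min lexx !orbT.
  by rewrite ler_pdivlMr ?ltr_wpDl//; lra.
pose e := Num.min r (delta / 2).
exists e; first by rewrite lt_min r0 divr_gt0.
exists (2 * c); first by rewrite mulr_ge0.
move=> x0 x1 x0e x1e x01.
have ed : e <= delta / 2 by rewrite ge_min lexx orbT.
have er : e <= r by rewrite ge_min lexx.
have rO p : `|p - x1| <= r -> Omega P p.
  move=> pr; apply: ball_O; rewrite -ball_normE /ball_ /=.
  have := ler_distD x1 x p; rewrite (distrC x x1) (distrC x1 p) => /le_lt_trans; apply.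
  by move: x1e er pr; rewrite /r; lra.
have D0 : `|x1 - x0| <= delta.
  by have := ler_distD x x1 x0; rewrite (distrC x x0); lra.
have [F1 [_ [F10 _ ctr]]] := Controllability HP.
have Ox0 : closure (Omega P) x0.
  by apply: subset_closure; apply: rO; rewrite distrC; lra.
have [a0 [_ [Aa0 _ _ _]]] := velocity_towards x01 F10 ctr Ox0.
have spec z : exists q : V * R * (R -> V), `|x1 - z| <= delta ->
    halving_step P c r x1 z q.1.1 q.1.2 q.2.
  have [zd|nzd] := boolP (`|x1 - z| <= delta); last by exists (a0, 0, fun=> a0).
  have [a [tau [y st]]] := step a0 x1 r delta z Aa0 r0 rO dd0 dr Fd zd.
  by exists (a, tau, y).
have [g gP] := choice spec.
have [||a [y [t [h1 h2 h3 h4 h5]]]] := @steer_concatenation F2 c r `|x1 - x0| x0 x1 a0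
  (fun z => (g z).1.1) (fun z => (g z).1.2) (fun z => (g z).2) F20 c0 FP Aa0 rO
  _ erefl.
- lra.
- by move=> z zD; apply: gP; exact: le_trans zD D0.
exists a, y, t; split => //; first by rewrite -mulrA.
by move=> s st; apply: rO; exact: h5.
Qed.

End Steer.

(** * Continuity at the reachable safe set *)

Theorem proposition4p7 (R : realType) (n : nat)
    (P : budget_reset_problem R n) (x : 'rV[R]_n) (b : R) :
  standing_assumptions P ->
  (boundary (reachable_safe_set P) `\` boundary (Omega P)) x ->
  0 < b < B P ->
  w1 P x' b @[x' --> within (U P) (nbhs x)] --> w2 P x.
Proof.
move=> HP [[clx _] nbx] /andP[b0 bB].
have Sx : S P x.
  have : closure (S P) x.
    by apply: closure_subset clx => p [].
  by apply: (safe_closed HP).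
have Ox : Omega P x.
  have cOx : closure (Omega P) x.
    by have [<- _ _ _ _] := Splitting HP; right.
  apply: contrapT => nOx; apply: nbx; split => // /interior_subset; exact: nOx.
have [e e0 [C C0 st]] := steer HP Ox.
have [K2 K20 KP] := cost_bound HP.
have [k2 k20 kP] := rate_bound HP.
pose d x' := (K2 * (C * `|x - x'|)).
have near_w : \forall x' \near within (U P) (nbhs x),
   (w2 P x - (d x')%:E <= w1 P x' b <= w2 P x + (d x')%:E)%E.
  rewrite near_withinE.
  (* A transfer from the unsafe point may spend [b]; a transfer to it may spend
     [B P - b], since [b] has to be left at its end. *)
  pose m := Num.min b (B P - b).
  have m0 : 0 < m by rewrite lt_min b0 subr_gt0.
  have kC0 : 0 < k2 * C + 1 by rewrite ltr_wpDl// mulr_ge0// ltW.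
  have : \forall x' \near nbhs x, `|x - x'| < Num.min e (m / (k2 * C + 1)).
    have : 0 < Num.min e (m / (k2 * C + 1)) by rewrite lt_min e0 divr_gt0.
    by move=> m'0; apply/nbhs_ballP; exists (Num.min e (m / (k2 * C + 1))) => //= y; rewrite -ball_normE.
  apply: filterS => x'; rewrite lt_min => /andP[xe xm] Ux'.
  have xx' : x' != x.
    by apply/eqP => xx'; apply: (safe_unsafe_disjoint HP Ux'); rewrite xx'.
  have x'e : `|x' - x| < e by rewrite distrC.
  have xxe : `|x - x| < e by rewrite subrr normr0.
  have small t : t <= C * `|x - x'| -> k2 * t <= m.
    move=> tC; apply: (@le_trans _ _ (k2 * (C * `|x - x'|))).
      by rewrite ler_wpM2l// ltW.
    rewrite mulrA; apply: (@le_trans _ _ ((k2 * C + 1) * `|x - x'|)).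
      by rewrite ler_wpM2r// lerDl.
    by rewrite mulrC -ler_pdivlMr// ltW.
  have costd t : 0 <= t <= C * `|x - x'| -> ((K2 * t)%:E <= (d x')%:E)%E.
    by move=> /andP[_ tC]; rewrite lee_fin ler_wpM2l// ltW.
  have [mb mB] : m <= b /\ m <= B P - b by rewrite !ge_min !lexx orbT.
  apply/andP; split.
    have [a [y [t [tt aa py yt yO]]]] := st x x' xxe x'e ltac:(by rewrite eq_sym).
    rewrite distrC in tt.
    have kt := small t ltac:(by case/andP: tt).
    have t0 : 0 <= t by case/andP: tt.
    rewrite leeBlDr//.
    apply: le_trans (w_splice (b2 := b) HP (ltW K20) KP (ltW k20) kP t0 aa py yt yO _ _ _) _ => //.
    - by lra.
    - by right; lra.
    - by apply: leeD; [exact: lexx|exact: costd].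
  have [a [y [t [tt aa py yt yO]]]] := st x' x x'e xxe xx'.
  have kt := small t ltac:(by case/andP: tt).
  have t0 : 0 <= t by case/andP: tt.
  apply: le_trans (w_splice (b2 := B P) HP (ltW K20) KP (ltW k20) kP t0 aa py yt yO _ _ _) _ => //.
  - by lra.
  - exact: ltW.
  - by left.
  - by apply: leeD; [exact: lexx|exact: costd].
have d_cvg : d x' @[x' --> within (U P) (nbhs x)] --> (0 : R).
  apply/cvgrPdist_lt => eps eps0; rewrite near_withinE.
  have KC0 : 0 <= K2 * C by rewrite mulr_ge0// ltW.
  have KC1 : 0 < K2 * C + 1 by rewrite ltr_wpDl.
  have : \forall x' \near x, `|x - x'| < eps / (K2 * C + 1).
    by apply/nbhs_ballP; exists (eps / (K2 * C + 1));
      [rewrite /= divr_gt0|move=> x'; rewrite -ball_normE].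
  apply: filterS => x' xx' _.
  rewrite sub0r normrN /d mulrA ger0_norm; last by rewrite mulr_ge0.
  apply: (@le_lt_trans _ _ ((K2 * C + 1) * `|x - x'|)).
    by rewrite ler_wpM2r// lerDl.
  by rewrite mulrC -ltr_pdivlMr.
apply: (squeeze_cvge near_w).
- rewrite -[X in _ --> X]sube0; apply: (@cvgeB _ _ _ _ (cst (w2 P x)) (EFin \o d)) => //.
  + by rewrite fin_num_adde_defl.
  + exact: cvg_cst.
  + by apply: cvg_EFin; [exact: nearW|exact: d_cvg].
- rewrite -[X in _ --> X]adde0; apply: (@cvgeD _ _ _ _ (cst (w2 P x)) (EFin \o d)) => //.
  + by rewrite fin_num_adde_defl.
  + exact: cvg_cst.
  + by apply: cvg_EFin; [exact: nearW|exact: d_cvg].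
Qed.
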